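(* Let $\Gamma_1$ and $\Gamma_2$ be bounded quasicircles in $\mathbb{C}$, and let $h\colon\Gamma_1\to\Gamma_2$ be a quasisymmetric homeomorphism. Assume that at least one of $\Gamma_1$ and $\Gamma_2$ is an asymptotically conformal quasicircle. If $h$ is equidistant weakly asymptotically symmetric (EWAS), then $h$ is asymptotically symmetric (AS). Consequently, the conditions EWAS, WAS (weakly asymptotically symmetric), and AS are equivalent in this case.
   Context: Let $X,Y$ be metric spaces with distances written $|x_1-x_2|$; subsets of $\mathbb{C}$ carry the Euclidean metric. An embedding $h\colon X\to Y$ (homeomorphism onto its image) is quasisymmetric if there is a homeomorphism $\eta\colon[0,\infty)\to[0,\infty)$ such that for any three distinct points $a,b,x\in X$ and $t\ge 0$, $\frac{|a-x|}{|b-x|}\le t$ implies $\frac{|h(a)-h(x)|}{|h(b)-h(x)|}\le\eta(t)$. A (bounded) quasicircle is a Jordan curve in $\mathbb{C}$ that admits a quasisymmetric parametrization by the unit circle. A bounded quasicircle $\Gamma$ is asymptotically conformal if $$\sup_{a,b\in\Gamma,\ 0<|a-b|\le r}\ \max_{w\in\Gamma[a,b]}\left(\frac{|a-w|+|w-b|}{|a-b|}-1\right)\to0\qquad(r\to0),$$ where $\Gamma[a,b]$ denotes the subarc of $\Gamma$ of smaller diameter joining $a$ and $b$. $h$ is asymptotically symmetric (AS) if for every $\varepsilon>0$ and every $t>0$ there exists $\delta>0$ such that for all distinct $a,b,x\in X$ with $\operatorname{diam}\{a,b,x\}\le\delta$: $\frac{|a-x|}{|b-x|}\le t$ implies $\frac{|h(a)-h(x)|}{|h(b)-h(x)|}\le(1+\varepsilon)t$.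 $h$ is weakly asymptotically symmetric (WAS) if this is required only for $t=1$ (for every $\varepsilon>0$). For $r>0$ put $$H_h^{\mathrm{eq}}(r)=\sup\left\{\max\left(\tfrac{|h(a)-h(x)|}{|h(b)-h(x)|},\tfrac{|h(b)-h(x)|}{|h(a)-h(x)|}\right): a,b,x\in X,\ |a-x|=|b-x|,\ 0<\operatorname{diam}\{a,b,x\}\le r\right\}.$$ $h$ is equidistant weakly asymptotically symmetric (EWAS) if $H_h^{\mathrm{eq}}(r)\to1$ as $r\to0$. *)

(* Defs.v *)
From HB Require Import structures.
From mathcomp Require Import all_boot all_order all_algebra.
From mathcomp Require Import all_classical all_reals all_analysis.
From mathcomp Require Export complex.

Set Implicit Arguments.
Unset Strict Implicit.
Unset Printing Implicit Defensive.

Import Order.TTheory GRing.Theory Num.Theory.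
Import numFieldNormedType.Exports.

Local Open Scope classical_set_scope.
Local Open Scope ring_scope.

(* The complex plane is [Rcomplex R], whose norm is the modulus with values in
   [R] (the norm of [R[i]] takes its values in [R[i]]).  The library gives it
   the structures of an R-module and of a normed group; its topology and its
   distance |x - y| are derived from that norm here. *)
Section complex_plane.
Variable R : realType.
Local Notation C := (Rcomplex R).

HB.instance Definition _ := PseudoMetric.copy C (pseudoMetric_normed C).
HB.instance Definition _ := isPointed.Build C 0.
HB.instance Definition _ := NormedZmod_PseudoMetric_eq.Build R C erefl.

Let normcZ (l : R) (x : C) : `|l *: x| = `|l| * `|x|.
Proof.
case: x => a b; rewrite /Num.norm/= !exprMn -mulrDr sqrtrM ?sqr_ge0//.
by rewrite sqrtr_sqr.
Qed.

HB.instance Definition _ :=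
  PseudoMetricNormedZmod_Lmodule_isNormedModule.Build R C normcZ.

Let dist (x y : C) : R := `|x - y|.

Let dist_ge0 x y : 0 <= dist x y. Proof. exact: normr_ge0. Qed.

Let dist_positivity x y : dist x y = 0 -> x = y.
Proof. by move/normr0_eq0/eqP; rewrite subr_eq0 => /eqP. Qed.

Let ballEdist x d : ball x d = [set y | dist x y < d].
Proof. by []. Qed.

HB.instance Definition _ :=
  PseudoMetric_isMetric.Build R C dist_ge0 dist_positivity ballEdist.

End complex_plane.

(* A map defined on a subset [A] is encoded by a total function of which only
   the values on [A] matter. *)
Definition embedding {U V : topologicalType} (A : set U) (f : U -> V) : Prop :=
  exists g : V -> U, [/\ {within A, continuous f},
    {within f @` A, continuous g} & {in A, cancel f g}].

Definition homeomorphism {U V : topologicalType} (A : set U) (B : set V)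
    (f : U -> V) : Prop :=
  embedding A f /\ f @` A = B.

Section metric_maps.
Context {R : realType} {X Y : metricType R}.
Implicit Types (A : set X) (h : X -> Y).

Definition diam {Z : metricType R} (E : set Z) : \bar R :=
  ereal_sup [set (mdist p.1 p.2)%:E | p in E `*` E].

Definition quasisymmetric A h : Prop :=
  embedding A h /\
  exists2 eta : R -> R, homeomorphism `[0 : R, +oo[ `[0 : R, +oo[ eta &
    forall (a b x : X) (t : R), A a -> A b -> A x -> uniq [:: a; b; x] ->
      0 <= t -> mdist a x / mdist b x <= t ->
      mdist (h a) (h x) / mdist (h b) (h x) <= eta t.

Definition asymptotically_symmetric_at A h (t : R) : Prop :=
  forall eps : R, 0 < eps -> exists2 delta : R, 0 < delta &
    forall a b x : X, A a -> A b -> A x -> uniq [:: a; b; x] ->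
      (diam [set a; b; x] <= delta%:E)%E ->
      mdist a x / mdist b x <= t ->
      mdist (h a) (h x) / mdist (h b) (h x) <= (1 + eps) * t.

Definition asymptotically_symmetric A h : Prop :=
  forall t : R, 0 < t -> asymptotically_symmetric_at A h t.

Definition weakly_asymptotically_symmetric A h : Prop :=
  asymptotically_symmetric_at A h 1.

(* The points [a] and [b] may coincide.  The supremum is [-oo] when no triple is
   admissible, i.e. when no two distinct points of [A] are at distance at most
   [r]. *)
Definition equidistant_distortion A h (r : R) : \bar R :=
  ereal_sup [set s | exists a b x : X,
    [/\ A a, A b & A x] /\
    [/\ mdist a x = mdist b x, (0 < diam [set a; b; x] <= r%:E)%E &
        s = (Num.max (mdist (h a) (h x) / mdist (h b) (h x))
                     (mdist (h b) (h x) / mdist (h a) (h x)))%:E]].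

Definition equidistant_weakly_asymptotically_symmetric A h : Prop :=
  equidistant_distortion A h r @[r --> (0 : R)^'+] --> 1%:E.

End metric_maps.

Section plane_curves.
Context {R : realType}.
Local Notation C := (Rcomplex R).
Implicit Types (Gamma E : set C) (a b : C).

Definition unit_circle : set C := [set z | `|z| = 1].

Definition jordan_curve Gamma : Prop :=
  exists f : C -> C, homeomorphism unit_circle Gamma f.

Definition quasicircle Gamma : Prop :=
  jordan_curve Gamma /\
  exists2 f : C -> C, quasisymmetric unit_circle f & f @` unit_circle = Gamma.

Definition subarc Gamma a b E : Prop :=
  E `<=` Gamma /\
  exists gamma : R -> C,
    [/\ homeomorphism `[0 : R, 1] E gamma, gamma 0 = a & gamma 1 = b].

(* [E] is the subarc of smaller diameter joining [a] and [b]; when the two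
   subarcs have the same diameter, both qualify. *)
Definition minor_subarc Gamma a b E : Prop :=
  subarc Gamma a b E /\
  forall E', subarc Gamma a b E' -> (diam E <= diam E')%E.

Definition conformality_defect Gamma (r : R) : \bar R :=
  ereal_sup [set s | exists a b E,
    [/\ Gamma a, Gamma b, 0 < mdist a b <= r, minor_subarc Gamma a b E &
        s = ereal_sup [set ((mdist a w + mdist w b) / mdist a b - 1)%:E
                      | w in E]]].

Definition asymptotically_conformal Gamma : Prop :=
  conformality_defect Gamma r @[r --> (0 : R)^'+] --> 0%:E.

End plane_curves.

(* Main.v *)
(* Blow up the curves.  Suppose that h distorts some ratio |u - x| / |v - x| by a
   definite factor at arbitrarily small scales; rescale both curves about x and
   h x by |v - x| and |h v - h x| and pass to a limit along an ultrafilter.  The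
   asymptotically conformal curve becomes a line (of three nearby points one is
   almost between the other two), and h, or its inverse when it is the target
   that is asymptotically conformal, becomes a map H from the line into the plane
   with controlled ratios.  On a Jordan curve a point u close to x has a
   companion v on the other side of x with |v - x| = |u - x|, so in both cases
   |H (y + s) - H y| = |H y - H (y - s)| for all y and s.

   Such a map is affine.  On a grid y + s Z the images of the edges have equal
   length, the cosines of the turning angles are 2-periodic and the products of
   the sines of consecutive angles are 3-periodic.  If two consecutive sines are
   nonzero, the turning angles are 6-periodic; the image of the grid being
   unbounded, they have total angle zero over a period, which forces the two
   cosines to agree.  With the connectedness of the line this yields, for every s,
   a grid on which no turning occurs, so that H is affine on it; let s -> 0.
   Hence the blow-up preserves ratios of distances from the base point, a
   contradiction. *)
Require Import Defs.
From mathcomp Require Import all_boot all_order all_algebra.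
From mathcomp Require Import all_classical all_reals all_analysis.
From mathcomp Require Import ring lra.

Set Implicit Arguments.
Unset Strict Implicit.
Unset Printing Implicit Defensive.

Import Order.TTheory GRing.Theory Num.Theory.
Import numFieldNormedType.Exports.
Import complex.

Local Open Scope classical_set_scope.
Local Open Scope ring_scope.

(** * Plane geometry *)

Section plane_norm.
Variable R : realType.
Implicit Types z w : Rcomplex R.

Lemma normC_sqr z : `|z| ^+ 2 = Re z ^+ 2 + Im z ^+ 2.
Proof. by case: z => a b; rewrite /Num.norm /= sqr_sqrtr// addr_ge0// sqr_ge0. Qed.

Lemma normRCM z w : `|(z * w : Rcomplex R)| = `|z| * `|w|.
Proof. exact: Normc.normcM. Qed.

Lemma ReCM z w : Re (z * w : Rcomplex R) = Re z * Re w - Im z * Im w.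
Proof. by case: z w => a b [c d]. Qed.

Lemma ImCM z w : Im (z * w : Rcomplex R) = Re z * Im w + Im z * Re w.
Proof. by case: z w => a b [c d]. Qed.

Lemma ReCB z w : Re (z - w : Rcomplex R) = Re z - Re w.
Proof. by case: z w => a b [c d]. Qed.

Lemma ImCB z w : Im (z - w : Rcomplex R) = Im z - Im w.
Proof. by case: z w => a b [c d]. Qed.

Lemma ReCD z w : Re (z + w : Rcomplex R) = Re z + Re w.
Proof. by case: z w => a b [c d]. Qed.

Lemma ImCD z w : Im (z + w : Rcomplex R) = Im z + Im w.
Proof. by case: z w => a b [c d]. Qed.

Lemma ReC_div z w : Re (z / w : Rcomplex R) =
  (Re z * Re w + Im z * Im w) / (Re w ^+ 2 + Im w ^+ 2).
Proof. by case: z w => a b [c d]; rewrite /= -/(GRing.inv _); ring. Qed.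

Lemma ImC_div z w : Im (z / w : Rcomplex R) =
  (Im z * Re w - Re z * Im w) / (Re w ^+ 2 + Im w ^+ 2).
Proof. by case: z w => a b [c d] /=; ring. Qed.

Lemma eq_ReIm z w : Re z = Re w -> Im z = Im w -> z = w.
Proof. by case: z w => a b [c d] /= -> ->. Qed.

Lemma Re_le_norm z : `|Re z| <= `|z|.
Proof.
rewrite -ler_sqr ?nnegrE// normC_sqr real_normK ?num_real//.
by rewrite lerDl sqr_ge0.
Qed.

Lemma Im_le_norm z : `|Im z| <= `|z|.
Proof.
rewrite -ler_sqr ?nnegrE// normC_sqr real_normK ?num_real//.
by rewrite lerDr sqr_ge0.
Qed.

Lemma norm_le_ReIm z : `|z| <= `|Re z| + `|Im z|.
Proof.
rewrite -ler_sqr ?nnegrE ?addr_ge0// normC_sqr sqrrD !real_normK ?num_real//.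
by rewrite lerD2r lerDl mulrn_wge0// mulr_ge0.
Qed.

Lemma Re_continuous : continuous (@Re R : Rcomplex R -> R).
Proof.
move=> z; have F : Filter (nbhs z) by exact: nbhs_filter.
apply/(@cvgrPdist_lt _ _ _ (nbhs z)) => e e0.
apply/nbhs_ballP; exists e => //= w zw.
by rewrite -ReCB; exact: le_lt_trans (Re_le_norm _) zw.
Qed.

Lemma Im_continuous : continuous (@Im R : Rcomplex R -> R).
Proof.
move=> z; have F : Filter (nbhs z) by exact: nbhs_filter.
apply/(@cvgrPdist_lt _ _ _ (nbhs z)) => e e0.
apply/nbhs_ballP; exists e => //= w zw.
by rewrite -ImCB; exact: le_lt_trans (Im_le_norm _) zw.
Qed.

Lemma normRC_div z w : `|(z / w : Rcomplex R)| = `|z| / `|w|.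
Proof.
have [->|w0] := eqVneq w 0; first by rewrite invr0 mulr0 !normr0 invr0 mulr0.
have wn : `|w| != 0 by rewrite normr_eq0.
by apply: (mulIf wn); rewrite -normRCM !divfK.
Qed.

Lemma mulC_eq1 z w : `|z| = 1 -> z * w = 1 :> Rcomplex R ->
  Re w = Re z /\ Im w = - Im z.
Proof.
move=> z1 zw.
have z2 : Re z ^+ 2 + Im z ^+ 2 = 1 by rewrite -normC_sqr z1 expr1n.
have := congr1 (@Re R) zw; have := congr1 (@Im R) zw.
rewrite ReCM ImCM /= => i0 r1; split.
  transitivity ((Re z ^+ 2 + Im z ^+ 2) * Re w); first by rewrite z2 mul1r.
  transitivity (Re z * (Re z * Re w - Im z * Im w)
    + Im z * (Re z * Im w + Im z * Re w)); first by ring.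
  by rewrite i0 r1 mulr0 addr0 mulr1.
transitivity ((Re z ^+ 2 + Im z ^+ 2) * Im w); first by rewrite z2 mul1r.
transitivity (Re z * (Re z * Im w + Im z * Re w)
  - Im z * (Re z * Re w - Im z * Im w)); first by ring.
by rewrite i0 r1 mulr0 add0r mulr1.
Qed.

End plane_norm.

Section rotation_orbit.
Variable R : realType.
Local Notation C := (Rcomplex R).

(* If the increments of [q] are multiplied by [w] every [p] steps, then [q] is
   the orbit of a rotation of angle [arg w] about the point [z]. *)
Lemma rotation_orbit (q : nat -> C) (p : nat) (w : C) :
  `|w| = 1 -> w != 1 ->
  (forall n, q (n + p).+1 - q (n + p)%N = w * (q n.+1 - q n)) ->
  exists z, forall k, `|q (k * p)%N - z| = `|q 0%N - z|.
Proof.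
move=> w1 wn1 qp; pose D := q p - w * q 0%N.
have w10 : 1 - w != 0 by rewrite subr_eq0 eq_sym.
have qD n : q (n + p)%N = w * q n + D.
  elim: n => [|n IH]; first by rewrite add0n /D addrC subrK.
  have := qp n; rewrite IH addSn => /eqP; rewrite subr_eq => /eqP ->.
  by ring.
exists (D / (1 - w)) => k; elim: k => [|k <-]; first by rewrite mul0n.
rewrite mulSn addnC qD.
have -> : w * q (k * p)%N + D - D / (1 - w) = w * (q (k * p)%N - D / (1 - w)).
  by field.
by rewrite normRCM w1 mul1r.
Qed.

End rotation_orbit.

(** * Rigidity of equidistant maps of the line *)

Section unimodular_sequence.
Variable R : realType.
Local Notation C := (Rcomplex R).
(** The [t i] model the turnings at consecutive vertices of a polygon with equal edges; [per2] and
    [per6] say that periodic turnings compose to the identity over a period. *)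
Variable t : nat -> C.
Hypothesis t_norm : forall i, `|t i| = 1.
Hypothesis Re_t : forall i, Re (t i.+2) = Re (t i).
Hypothesis Im_t : forall i,
  Im (t i) * Im (t i.+1) = Im (t i.+3) * Im (t i.+4).
Hypothesis per2 : (forall i, t i.+2 = t i) -> t 0%N * t 1%N = 1.
Hypothesis per6 : (forall i, t i.+4.+2 = t i) ->
  t 0%N * t 1%N * t 2%N * t 3%N * t 4%N * t 5%N = 1.
Hypothesis Im_t0 : Im (t 0%N) != 0.
Hypothesis Im_t1 : Im (t 1%N) != 0.

Let sqr_t i : Re (t i) ^+ 2 + Im (t i) ^+ 2 = 1.
Proof. by rewrite -normC_sqr t_norm expr1n. Qed.

Let Im_t2 i : Im (t i.+2) = Im (t i) \/ Im (t i.+2) = - Im (t i).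
Proof.
have /eqP : Im (t i.+2) ^+ 2 = Im (t i) ^+ 2.
  by apply: (addrI (Re (t i) ^+ 2)); rewrite -{1}Re_t !sqr_t.
by rewrite eqf_sqr => /orP[] /eqP; [left|right].
Qed.

Let Im_neq0 i : Im (t i) != 0.
Proof.
suff : Im (t i) != 0 /\ Im (t i.+1) != 0 by case.
elim: i => [//|i [IH1 IH2]]; split=> //.
by have [->|->] := Im_t2 i; rewrite ?oppr_eq0.
Qed.

Let Im_t4 i : Im (t i.+4) = Im (t i) * Im (t i.+1) / Im (t i.+3).
Proof. by rewrite Im_t mulrAC mulfV ?mul1r. Qed.

(** Three uses of the recurrence [Im_t4] lead from [Im (t 6)] back to [Im (t 0)]; [Im_t] then
    propagates the period. *)
Let t_per6 i : t i.+4.+2 = t i.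
Proof.
apply: eq_ReIm; first by rewrite !Re_t.
elim: i => [|i IH].
  rewrite (Im_t4 2%N) (Im_t4 1%N) (Im_t4 0%N); have N := Im_neq0.
  by field; rewrite (N 0%N) (N 1%N) (N 2%N) (N 3%N).
by rewrite (Im_t4 i.+3) IH -Im_t mulrAC mulfV ?mul1r.
Qed.

Let conj_mul (z w : C) : `|z| = 1 -> Re w = Re z -> Im w = - Im z -> z * w = 1 :> C.
Proof.
move=> z1 rw iw; apply: eq_ReIm.
  by rewrite ReCM rw iw mulrN opprK -!expr2 -normC_sqr z1 expr1n.
by rewrite ImCM rw iw mulrN mulrC addNr.
Qed.

Let Re_of_mul1 (z w : C) : `|z| = 1 -> z * w = 1 -> Re w = Re z.
Proof. by move=> z1 /(mulC_eq1 z1)[]. Qed.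

(* Up to conjugation [t] is [a, b, a, b, ...], and the signs of the imaginary
   parts follow one of four 6-periodic patterns; in each of them the product
   over the period is [a * b] or [a / b], up to conjugation. *)
Lemma unimodular_sequence_Re : Re (t 0%N) = Re (t 1%N).
Proof.
have Re2 : Re (t 2%N) = Re (t 0%N) := Re_t 0.
have Re3 : Re (t 3%N) = Re (t 1%N) := Re_t 1.
have Re4 : Re (t 4%N) = Re (t 0%N) by rewrite Re_t.
have Re5 : Re (t 5%N) = Re (t 1%N) by rewrite Re_t.
have I4 := Im_t4 0; have I5 := Im_t4 1.
have N0 := Im_t0; have N1 := Im_t1; have N4 := Im_neq0 4.
have P6 := per6 t_per6.
have [E2|E2] := Im_t2 0; have [E3|E3] := Im_t2 1.
(* The cases are the signs of [Im (t 2) / Im (t 0)] and [Im (t 3) / Im (t 1)]. Two plus signs make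
   [t] 2-periodic, so [per2] applies; the other cases use [per6]. *)
- apply/esym/Re_of_mul1 => //; apply: per2 => i.
  suff H : Im (t i.+2) = Im (t i) /\ Im (t i.+3) = Im (t i.+1).
    by apply: eq_ReIm; [exact: Re_t|case: H].
  elim: i => [//|i [IH1 IH2]]; split => //.
  by rewrite Im_t4 IH2 IH1 mulfK.
- have {}I4 : Im (t 4%N) = - Im (t 0%N) by rewrite I4 E3; field.
  have {}I5 : Im (t 5%N) = - Im (t 1%N) by rewrite I5 I4 E2; field.
  have t13 : t 1%N * t 3%N = 1 by exact: conj_mul.
  have t04 : t 0%N * t 4%N = 1 by exact: conj_mul.
  have t2 : t 2%N = t 0%N by exact: eq_ReIm.
  have t5 : t 5%N = t 3%N by apply: eq_ReIm; rewrite ?E3 ?Re3 ?Re5.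
  have t03 : t 0%N * t 3%N = 1.
    transitivity (t 0%N * t 3%N * (t 1%N * t 3%N) * (t 0%N * t 4%N)).
      by rewrite t13 t04 !mulr1.
    by rewrite -P6 t2 t5; ring.
  by rewrite -Re3; apply/esym/Re_of_mul1.
- have {}I4 : Im (t 4%N) = Im (t 0%N) by rewrite I4 E3 mulfK.
  have {}I5 : Im (t 5%N) = - Im (t 1%N) by rewrite I5 I4 E2; field.
  have t02 : t 0%N * t 2%N = 1 by exact: conj_mul.
  have t15 : t 1%N * t 5%N = 1 by exact: conj_mul.
  have t3 : t 3%N = t 1%N by exact: eq_ReIm.
  have t4 : t 4%N = t 0%N by exact: eq_ReIm.
  have t01 : t 0%N * t 1%N = 1.
    transitivity (t 0%N * t 1%N * (t 0%N * t 2%N) * (t 1%N * t 5%N)).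
      by rewrite t02 t15 !mulr1.
    by rewrite -P6 t3 t4; ring.
  by apply/esym/Re_of_mul1.
- have {}I4 : Im (t 4%N) = - Im (t 0%N) by rewrite I4 E3; field.
  have {}I5 : Im (t 5%N) = Im (t 1%N) by rewrite I5 I4 E2; field.
  have t04 : t 0%N * t 4%N = 1 by exact: conj_mul.
  have t13 : t 1%N * t 3%N = 1 by exact: conj_mul.
  have t2 : t 2%N = t 4%N by apply: eq_ReIm; rewrite ?E2 ?Re2 ?Re4.
  have t5 : t 5%N = t 1%N by exact: eq_ReIm.
  have t41 : t 4%N * t 1%N = 1.
    transitivity (t 4%N * t 1%N * (t 0%N * t 4%N) * (t 1%N * t 3%N)).
      by rewrite t04 t13 !mulr1.
    by rewrite -P6 t2 t5; ring.
  by rewrite -Re4; apply/esym/Re_of_mul1.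
Qed.

End unimodular_sequence.

(** * Equidistant maps of the line into the plane are affine *)

Section equidistant_map.
Variable R : realType.
Local Notation C := (Rcomplex R).
Variable H : R -> C.
Hypothesis H_equi : forall x s, `|H (x + s) - H x| = `|H x - H (x - s)|.
Hypothesis H_inj : injective H.
Hypothesis H_cont : continuous H.
Hypothesis H_unbounded :
  forall x s B : R, 0 < s -> exists n : nat, B < `|H (x + s *+ n) - H x|.

Section step.
Variable s : R.
Hypothesis s_gt0 : 0 < s.

(** [e y] is an edge of the image polygon of the grid, and [tau y] the turning at the vertex
    [H y]. *)
Let e y : C := H (y + s) - H y.
Let tau y : C := e y / e (y - s).

Let e_neq0 y : e y != 0.
Proof.
apply/eqP => /eqP; rewrite subr_eq0 => /eqP /H_inj /eqP.
by rewrite -subr_eq0 addrAC subrr add0r gt_eqF.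
Qed.

Let norm_e y : `|e (y + s)| = `|e y|.
Proof. by rewrite /e (H_equi (y + s) s) addrK. Qed.

Let norm_tau y : `|tau y| = 1.
Proof.
have := norm_e (y - s); rewrite subrK => ey.
have en : `|e y| != 0 by rewrite normr_eq0 e_neq0.
apply: (mulIf en); rewrite {1}ey -normRCM /tau divfK ?mul1r//.
Qed.

Let tauE y : e (y + s) = tau (y + s) * e y.
Proof. by rewrite /tau addrK divfK. Qed.

Let norm_sum2 y : `|H (y + s + s) - H y| ^+ 2 =
  `|e y| ^+ 2 * (2 + 2 * Re (tau (y + s))).
Proof.
have -> : H (y + s + s) - H y = e y * (1 + tau (y + s)).
  rewrite mulrDr mulr1 [e y * tau _]mulrC -tauE /e.
  by ring.
have := norm_tau (y + s) => /(congr1 (fun r => r ^+ 2)).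
rewrite expr1n normC_sqr => n1.
rewrite normRCM exprMn; congr (_ * _); rewrite normC_sqr ReCD ImCD /=.
move: n1; set a := Re _; set b := Im _ => n1.
by rewrite (_ : 2 + _ = 1 + (a ^+ 2 + b ^+ 2) + 2 * a); [ring|rewrite n1; ring].
Qed.

(** By [H_equi] with step [s + s], the chords over two edges on either side of [H (y + s)] have
    equal length; as all edges are equal, so are the cosines of the turnings they span. *)
Let Re_tau_per y : Re (tau (y + s + s)) = Re (tau y).
Proof.
have := norm_sum2 (y + s); have := norm_sum2 (y - s); rewrite subrK.
have -> : y + s + s + s = y + s + (s + s) by ring.
rewrite (H_equi (y + s) (s + s)).
have -> : y + s - (s + s) = y - s by ring.
move=> ->; rewrite norm_e -(norm_e (y - s)) subrK.
have en : `|e y| ^+ 2 != 0 by rewrite expf_neq0// normr_eq0 e_neq0.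
by move=> /(mulfI en) /addrI /(mulfI _) -> //; rewrite pnatr_eq0.
Qed.

Let norm_sum3 y : `|H (y + s + s + s) - H y| ^+ 2 =
  `|e y| ^+ 2 * (3 + 2 * Re (tau (y + s)) + 2 * Re (tau (y + s + s)) +
    2 * Re (tau (y + s) * tau (y + s + s))).
Proof.
have -> : H (y + s + s + s) - H y =
    e y * (1 + tau (y + s) + tau (y + s) * tau (y + s + s)).
  transitivity (e y + e (y + s) + e (y + s + s)); first by rewrite /e; ring.
  by rewrite (tauE (y + s)) (tauE y); ring.
have := norm_tau (y + s) => /(congr1 (fun r => r ^+ 2)).
rewrite expr1n normC_sqr => n1.
have := norm_tau (y + s + s) => /(congr1 (fun r => r ^+ 2)).
rewrite expr1n normC_sqr => n2.
rewrite normRCM exprMn; congr (_ * _); rewrite normC_sqr !ReCD !ImCD ReCM ImCM /=.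
move: n1 n2; set a := Re _; set b := Im _; set c := Re _; set d := Im _.
move=> n1 n2; transitivity (1 + (a ^+ 2 + b ^+ 2) +
  (a ^+ 2 + b ^+ 2) * (c ^+ 2 + d ^+ 2) + 2 * a +
  2 * (a ^+ 2 + b ^+ 2) * c + 2 * (a * c - b * d)); first by ring.
by rewrite n1 n2; ring.
Qed.

(** The same comparison with chords over three edges: the cosines and their products cancel by
    [Re_tau_per], which leaves the products of sines. *)
Let Im_tau_mul y : Im (tau y) * Im (tau (y + s)) =
  Im (tau (y + s + s + s)) * Im (tau (y + s + s + s + s)).
Proof.
have := norm_sum3 (y + s + s); have := norm_sum3 (y - s); rewrite subrK.
have -> : y + s + s + s + s + s = y + s + s + (s + s + s) by ring.
rewrite (H_equi (y + s + s) (s + s + s)).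
have -> : y + s + s - (s + s + s) = y - s by ring.
move=> ->; rewrite !norm_e -(norm_e (y - s)) subrK.
have en : `|e y| ^+ 2 != 0 by rewrite expf_neq0// normr_eq0 e_neq0.
move=> /(mulfI en); rewrite (ReCM (tau y)) (ReCM (tau (y + s + s + s))) !Re_tau_per.
by move=> E; lra.
Qed.

(** Periodic turnings make the edges recur every [p] steps up to a fixed rotation [w]. Were [w] not
    1, every [p]-th vertex would lie on one circle, against [H_unbounded]. *)
Let periodic_increments y p : (0 < p)%N ->
  (forall n : nat, tau (y + s *+ (n + p).+1) = tau (y + s *+ n.+1)) ->
  e (y + s *+ p) = e y.
Proof.
move=> p0 tp.
have eS n : e (y + s *+ n.+1) = tau (y + s *+ n.+1) * e (y + s *+ n).
  by have -> : y + s *+ n.+1 = y + s *+ n + s; rewrite ?tauE// mulrSr addrA.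
pose w : C := e (y + s *+ p) / e y.
have ep n : e (y + s *+ (n + p)) = w * e (y + s *+ n).
  elim: n => [|n IH].
    by rewrite add0n mulr0n addr0 /w divfK.
  by rewrite addSn !eS IH tp mulrCA.
have norm_ep n : `|e (y + s *+ n)| = `|e y|.
  elim: n => [|n IH]; first by rewrite addr0.
  by rewrite mulrSr addrA norm_e.
have w1 : `|w| = 1.
  have en : `|e y| != 0 by rewrite normr_eq0 e_neq0.
  by apply: (mulIf en); rewrite -normRCM /w divfK ?e_neq0// norm_ep mul1r.
apply: contrapT => /eqP epn.
have wn1 : w != 1.
  by apply: contra epn => /eqP w_eq1; have := ep 0%N;
    rewrite add0n addr0 w_eq1 mul1r => ->.
pose q n := H (y + s *+ n).
have qS n : q n.+1 - q n = e (y + s *+ n) by rewrite /q /e mulrSr addrA.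
have [z qz] : exists z, forall k, `|q (k * p)%N - z| = `|q 0%N - z|.
  apply: (rotation_orbit w1 wn1) => n.
  by rewrite !qS ep.
have sp_gt0 : 0 < s *+ p by rewrite pmulrn_lgt0.
have [n] := H_unbounded y (`|q 0%N - z| + `|q 0%N - z|) sp_gt0.
apply/negP; rewrite -leNgt -{1}(qz n) (distrC (q 0%N) z).
have -> : H (y + s *+ p *+ n) - H y = (q (n * p)%N - z) + (z - q 0%N).
  by rewrite /q addr0 -mulrnA mulnC; ring.
exact: ler_normD.
Qed.

(** The index is shifted: [tau_at y i] turns edge [i] of the grid from [y] into edge [i.+1]. *)
Let tau_at y i : C := tau (y + s *+ i.+1).

Let eSS y i : e (y + s *+ i + s) = tau_at y i * e (y + s *+ i).
Proof. by rewrite tauE /tau_at mulrSr addrA. Qed.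

Let e_at y p : e (y + s *+ p) = e y -> \prod_(i < p) tau_at y i = 1.
Proof.
have eE n : e (y + s *+ n) = (\prod_(i < n) tau_at y i) * e y.
  elim: n => [|n IH]; first by rewrite big_ord0 mul1r addr0.
  by rewrite mulrSr addrA eSS IH big_ord_recr /=; ring.
by rewrite eE => /eqP; rewrite -subr_eq0 -{2}[e y]mul1r -mulrBl mulf_eq0
  (negbTE (e_neq0 y)) orbF subr_eq0 => /eqP.
Qed.

Let Re_tau_eq y : Im (tau y) != 0 -> Im (tau (y + s)) != 0 ->
  Re (tau y) = Re (tau (y + s)).
Proof.
move=> I0 I1.
(* The grid starts at [y - s], so that its first two turnings are [tau y] and [tau (y + s)]. *)
have t0 : tau_at (y - s) 0 = tau y by rewrite /tau_at mulr1n subrK.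
have t1 : tau_at (y - s) 1 = tau (y + s).
  by rewrite /tau_at; congr tau; rewrite mulr2n; ring.
have E k : y - s + s *+ k.+1 = y - s + s *+ k + s by rewrite mulrSr addrA.
rewrite -t0 -t1.
apply: (@unimodular_sequence_Re R (tau_at (y - s))).
- by move=> i; exact: norm_tau.
- by move=> i; rewrite /tau_at (E i.+2) (E i.+1) Re_tau_per.
- by move=> i; rewrite /tau_at (E i.+4) (E i.+3) (E i.+2) (E i.+1); exact: Im_tau_mul.
- move=> t2; have := @e_at (y - s) 2; rewrite !big_ord_recr big_ord0 /= mul1r.
  by apply; apply: periodic_increments => // n; rewrite addn2; exact: t2.
- move=> t6; have := @e_at (y - s) 6; rewrite !big_ord_recr big_ord0 /= mul1r.
  by apply; apply: periodic_increments => // n; rewrite addnC; exact: t6.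
- by rewrite t0.
- by rewrite t1.
Qed.
Let continuous_e_shift (f : C -> R) (r : R) :
  (forall z w, f (z - w) = f z - f w) -> continuous f ->
  continuous (fun y => f (e (y + r))).
Proof.
move=> fB f_cont y.
have -> : (fun y => f (e (y + r))) = fun y => f (H (y + (r + s))) - f (H (y + r)).
  by apply/funext => x; rewrite /e fB addrA.
have shift a : {for y, continuous (fun x => f (H (x + a)))}.
  apply: (@continuous_comp _ _ _ (fun x => H (x + a)) f); last exact: f_cont.
  apply: (@continuous_comp _ _ _ (fun x => x + a) H); last exact: H_cont.
  by apply: continuousD; [exact: cvg_id|exact: cvg_cst].
by apply: continuousB; exact: shift.
Qed.

Let ReIm_e_continuous : [/\ continuous (fun y => Re (e y)),
  continuous (fun y => Im (e y)),
  continuous (fun y => Re (e (y - s))) & continuous (fun y => Im (e (y - s)))].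
Proof.
have cont_re r : continuous (fun y => Re (e (y + r))).
  by apply: (continuous_e_shift (f := @Re R)); [exact: ReCB|exact: Re_continuous].
have cont_im r : continuous (fun y => Im (e (y + r))).
  by apply: (continuous_e_shift (f := @Im R)); [exact: ImCB|exact: Im_continuous].
by split=> //; [move: (cont_re 0)|move: (cont_im 0)];
  under [X in continuous X]eq_fun do rewrite addr0.
Qed.

Let sqr_e_neq0 y : Re (e (y - s)) * Re (e (y - s)) +
  Im (e (y - s)) * Im (e (y - s)) != 0.
Proof. by rewrite -!expr2 -normC_sqr expf_neq0// normr_eq0 e_neq0. Qed.

Let Re_tau_continuous : continuous (fun y => Re (tau y)).
Proof.
have [a b c d] := ReIm_e_continuous => y.
under eq_fun do rewrite /tau ReC_div !expr2.
apply: cvgM; first by apply: cvgD; apply: cvgM; [exact: a|exact: c|exact: b|exact: d].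
by apply: cvgV; rewrite ?sqr_e_neq0//; apply: cvgD; apply: cvgM;
  [exact: c|exact: c|exact: d|exact: d].
Qed.

Let Im_tau_continuous : continuous (fun y => Im (tau y)).
Proof.
have [a b c d] := ReIm_e_continuous => y.
under eq_fun do rewrite /tau ImC_div !expr2.
apply: cvgM; first by apply: cvgB; apply: cvgM; [exact: b|exact: c|exact: a|exact: d].
by apply: cvgV; rewrite ?sqr_e_neq0//; apply: cvgD; apply: cvgM;
  [exact: c|exact: c|exact: d|exact: d].
Qed.

Let sqr_tau y : Re (tau y) ^+ 2 + Im (tau y) ^+ 2 = 1.
Proof. by rewrite -normC_sqr norm_tau expr1n. Qed.

(* Otherwise all turning angles on the grid [s * Z] have the same sign, and the
   image of the grid lies on a circle. *)
Let exists_Im_tau0 : exists y, Im (tau y) = 0.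
Proof.
apply: contrapT => /forallNP I_neq0.
have same_sign y z : 0 < Im (tau y) -> 0 < Im (tau z).
  move=> y0; rewrite ltNge; apply/negP => z0.
  suff [u u0] : exists u, Im (tau u) = 0 by exact: I_neq0 u0.
  have cont a b : {within `[a, b], continuous (fun y => Im (tau y))}.
    exact: continuous_subspaceT.
  have [yz|/ltW zy] := leP y z.
    have [|u _ u0] := @IVT _ _ y z 0 yz (cont y z); last by exists u.
    by rewrite ge_min z0 orbT le_max (ltW y0).
  have [|u _ u0] := @IVT _ _ z y 0 zy (cont z y); last by exists u.
  by rewrite ge_min z0 le_max (ltW y0) orbT.
have same y z : 0 < Im (tau y) * Im (tau z).
  have /eqP ny := I_neq0 y; have /eqP nz := I_neq0 z.
  have [y0|y0] := ltP 0 (Im (tau y)); first by rewrite mulr_gt0// (same_sign y).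
  have {}y0 : Im (tau y) < 0 by rewrite lt_neqAle ny.
  rewrite nmulr_rgt0// lt_neqAle nz leNgt; apply/negP => /(same_sign z y).
  by rewrite ltNge (ltW y0).
(* A constant sign of the sines makes [tau] 2-periodic. Two consecutive turnings then multiply to 1,
   so they are conjugate and their sines have opposite signs. *)
have tau2 y : tau (y + s + s) = tau y.
  apply: eq_ReIm; first exact: Re_tau_per.
  have /eqP : Im (tau (y + s + s)) ^+ 2 = Im (tau y) ^+ 2.
    by apply: (addrI (Re (tau y) ^+ 2)); rewrite -{1}Re_tau_per !sqr_tau.
  rewrite eqf_sqr => /orP[/eqP//|/eqP E].
  have := same (y + s + s) y; rewrite E mulNr oppr_gt0 ltNge.
  by rewrite -expr2 sqr_ge0.
have := @e_at 0 2; rewrite !big_ord_recr big_ord0 /= mul1r.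
have -> : e (0 + s *+ 2) = e 0.
  apply: periodic_increments => // n.
  by rewrite addn2 2!(mulrSr s) 2!addrA tau2.
move=> /(_ erefl) t1.
have [_ E] := mulC_eq1 (norm_tau _) t1.
have := same (0 + s *+ 1) (0 + s *+ 2).
by rewrite {}E mulrN oppr_gt0 ltNge -expr2 sqr_ge0.
Qed.

(** A half-turn at [H y] would make [H (y + s)] and [H (y - s)] coincide. *)
Let Re_tau_gtN1 y : -1 < Re (tau y).
Proof.
have := norm_sum2 (y - s); rewrite subrK => E.
have : 0 < `|H (y + s) - H (y - s)| ^+ 2.
  rewrite exprn_gt0// normr_gt0 subr_eq0; apply/eqP => /H_inj /eqP.
  by apply/negP; rewrite gt_eqF// ltrD2l gtrN.
rewrite E pmulr_rgt0; last by rewrite exprn_gt0// normr_gt0 e_neq0.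
by lra.
Qed.

Let Re_tau_eq1 y : Im (tau y) = 0 -> Re (tau y) = 1.
Proof.
move=> i0; have := sqr_tau y; rewrite i0 expr0n addr0 => /eqP.
rewrite sqrf_eq1 => /orP[/eqP//|/eqP E].
by have := Re_tau_gtN1 y; rewrite E ltxx.
Qed.

Let Im_tau_eq0 y : Re (tau y) = 1 -> Im (tau y) = 0.
Proof.
move=> r1; have := sqr_tau y; rewrite r1 expr1n => /eqP.
by rewrite -subr_eq0 addrAC subrr add0r sqrf_eq0 => /eqP.
Qed.

(* Otherwise the zeros of [Im (tau y)] would form a clopen set. *)
Let exists_Im_tau00 : exists y, Im (tau y) = 0 /\ Im (tau (y + s)) = 0.
Proof.
apply: contrapT => /forallNP no_pair.
pose Z := [set y | Im (tau y) = 0].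
have Z_open : open Z.
  (* At a zero [y] the cosine is 1, but at [y + s] it is not. For nearby [x] the cosines at [x] and
     [x + s] still differ and the sine at [x + s] is still nonzero, so [Re_tau_eq] forces the sine
     at [x] to vanish. *)
  rewrite openE => y /= Zy; rewrite /interior.
  have y1 : Re (tau y) = 1 by exact: Re_tau_eq1.
  have ys_neq0 : Im (tau (y + s)) != 0 by apply/eqP => ?; exact: (no_pair y).
  have ys_neq1 : Re (tau y) - Re (tau (y + s)) != 0.
    by rewrite y1 subr_eq0 eq_sym; apply: contra_neq ys_neq0; exact: Im_tau_eq0.
  have shift_cont (f : R -> R) : continuous f -> continuous (fun x => f (x + s)).
    move=> fc x; apply: (@continuous_comp _ _ _ (fun x => x + s) f); last exact: fc.
    by apply: continuousD; [exact: cvg_id|exact: cvg_cst].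
  have c1 : {for y, continuous (fun x => Re (tau x) - Re (tau (x + s)))}.
    apply: continuousB; first exact: Re_tau_continuous.
    exact: (shift_cont _ Re_tau_continuous).
  have c2 : {for y, continuous (fun x => Im (tau (x + s)))}.
    exact: (shift_cont _ Im_tau_continuous).
  near=> x; apply: contrapT => /eqP x0.
  have : Re (tau x) - Re (tau (x + s)) != 0.
    by near: x; exact: (cvgr_neq0 _ c1).
  rewrite subr_eq0 => /eqP; apply; apply: Re_tau_eq => //.
  by near: x; exact: (cvgr_neq0 _ c2).
have Z_closed : closed Z.
  have -> : Z = (fun y => Im (tau y)) @^-1` [set 0] by [].
  apply: closed_comp; last exact: closed_eq.
  by move=> x _; exact: Im_tau_continuous.
have Z_all : Z = setT.
  have /connected_intervalP conn : is_interval (@setT R) by [].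
  apply: conn; first exact: exists_Im_tau0.
    by exists Z; rewrite ?setTI.
  by exists Z; rewrite ?setTI.
have ZT y : Z y by rewrite Z_all.
by apply: (no_pair 0); split; exact: ZT.
Unshelve. all: by end_near. Qed.

(** Two consecutive straight vertices propagate along the whole grid, the cosines being 2-periodic.
    The bound [B] lets the grid start to the left of any given points. *)
Lemma equidistant_map_grid B : exists2 y, y <= B &
  forall i : nat, H (y + s *+ i) - H y = (H (y + s) - H y) *+ i.
Proof.
have [y [y0 ys0]] := exists_Im_tau00.
have back n : Re (tau (y - s *+ (n * 2))) = 1 /\
    Re (tau (y - s *+ (n * 2) + s)) = 1.
  elim: n => [|n [IH1 IH2]]; first by rewrite subr0 !Re_tau_eq1.
  have E : y - s *+ (n.+1 * 2) + s + s = y - s *+ (n * 2).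
    by rewrite mulSn mulrnDr mulr2n; ring.
  by split; rewrite -Re_tau_per E.
have tau1 z : Re (tau z) = 1 -> tau z = 1.
  by move=> z1; apply: eq_ReIm => //; rewrite Im_tau_eq0.
(* Already [n] single steps cover the distance from [y] to [B], so [n] double steps backwards pass
   below [B]. *)
pose n := (Num.trunc (`|y - B| / s)).+1.
have [t1 t2] := back n; set x := y - s *+ (n * 2) in t1 t2.
exists x.
  have ns : `|y - B| < s *+ n.
    rewrite -mulr_natr mulrC -ltr_pdivrMr//.
    by have /andP[] := truncn_itv (divr_ge0 (normr_ge0 (y - B)) (ltW s_gt0)).
  rewrite /x lerBlDr -lerBlDl (le_trans (ler_norm _))// (le_trans (ltW ns))//.
  by rewrite -!(mulr_natr s) ler_wpM2l ?(ltW s_gt0)// ler_nat leq_pmulr.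
have tx i : tau (x + s *+ i) = 1.
  suff [] : Re (tau (x + s *+ i)) = 1 /\ Re (tau (x + s *+ i + s)) = 1.
    by move=> /tau1.
  elim: i => [|i [IH1 IH2]]; first by rewrite addr0.
  by rewrite mulrSr addrA Re_tau_per.
have ex i : e (x + s *+ i) = e x.
  elim: i => [|i IH]; first by rewrite addr0.
  by rewrite mulrSr addrA tauE -addrA -mulrSr tx mul1r.
elim=> [|i IH]; first by rewrite addr0 subrr mulr0n.
rewrite [in RHS]mulrSr -IH -[X in _ = _ + X]/(e x) -(ex i) /e mulrSr addrA.
by ring.
Qed.

End step.

(** A fine grid gives an exact proportionality between three grid points near 0, 1 and [t]; by
    continuity it passes to the limit as the mesh tends to 0. *)
Lemma equidistant_map_affine t : H t - H 0 = t *: (H 1 - H 0).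
Proof.
have cross (a b c y s : R) : (y + s * b - (y + s * a)) * (c - a) =
    (y + s * c - (y + s * a)) * (b - a) by ring.
have grid (n : nat) : exists p : R * R * R,
    [/\ `|0 - p.1.1| < n.+1%:R^-1, `|1 - p.1.2| < n.+1%:R^-1,
        `|t - p.2| < n.+1%:R^-1 &
        (p.1.2 - p.1.1) *: (H p.2 - H p.1.1) =
        (p.2 - p.1.1) *: (H p.1.2 - H p.1.1)].
  have s0 : 0 < n.+1%:R^-1 / 2 :> R by rewrite divr_gt0// invr_gt0.
  set s := _ / 2 in s0.
  have [y yB yE] := @equidistant_map_grid s s0 (Num.min 0 t).
  pose i r := Num.trunc ((r - y) / s).
  have iP r : y <= r -> `|r - (y + s *+ i r)| < n.+1%:R^-1.
    move=> yr; have : 0 <= (r - y) / s by rewrite divr_ge0 ?subr_ge0// ltW.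
    move=> /truncn_itv; rewrite ler_pdivlMr// ltr_pdivrMr// -/(i r).
    rewrite !mulr_natl [s *+ _.+1]mulrSr => /andP[i1 i2].
    rewrite ger0_norm; last by lra.
    have sn : s < n.+1%:R^-1 by rewrite ltr_pdivrMr// ltr_pMr ?invr_gt0// ltr1n.
    by rewrite (lt_trans _ sn)// opprD addrA ltrBlDl.
  have y0 : y <= 0 by rewrite (le_trans yB)// ge_min lexx.
  have yt : y <= t by rewrite (le_trans yB)// ge_min lexx orbT.
  exists (y + s *+ i 0, y + s *+ i 1, y + s *+ i t); split.
  - exact: iP.
  - by apply: iP; rewrite (le_trans y0).
  - exact: iP.
  - have dE j k : H (y + s *+ j) - H (y + s *+ k) =
        (j%:R - k%:R) *: (H (y + s) - H y).
      transitivity ((H (y + s *+ j) - H y) - (H (y + s *+ k) - H y)).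
        by ring.
      by rewrite !yE scalerBl !scaler_nat.
    rewrite /= !dE !scalerA; congr (_ *: _).
    by rewrite -!(mulr_natr s); exact: cross.
have [p pP] := choice grid.
have cvg_grid (f : R * R * R -> R) r :
    (forall n, `|r - f (p n)| < n.+1%:R^-1) -> f (p n) @[n --> \oo] --> r.
  move=> fr; apply/cvgrPdist_lt => eps eps0; near=> n.
  apply: (lt_trans (fr n)).
  by near: n; exact: near_infty_natSinv_lt (PosNum eps0).
have c0 := cvg_grid (fun q => q.1.1) 0 (fun n => let: And4 a _ _ _ := pP n in a).
have c1 := cvg_grid (fun q => q.1.2) 1 (fun n => let: And4 _ a _ _ := pP n in a).
have ct := cvg_grid (fun q => q.2) t (fun n => let: And4 _ _ a _ := pP n in a).
have hcvg (u : nat -> R) r : u n @[n --> \oo] --> r -> H (u n) @[n --> \oo] --> H r.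
  by move=> ur; apply: (cvg_comp _ _ ur); exact: H_cont.
have lhs : ((p n).1.2 - (p n).1.1) *: (H (p n).2 - H (p n).1.1) @[n --> \oo] -->
    (1 - 0) *: (H t - H 0).
  by apply: cvgZ; apply: cvgB => //; exact: hcvg.
have rhs : ((p n).2 - (p n).1.1) *: (H (p n).1.2 - H (p n).1.1) @[n --> \oo] -->
    (t - 0) *: (H 1 - H 0).
  by apply: cvgZ; apply: cvgB => //; exact: hcvg.
have E : (fun n => ((p n).1.2 - (p n).1.1) *: (H (p n).2 - H (p n).1.1)) =
    (fun n => ((p n).2 - (p n).1.1) *: (H (p n).1.2 - H (p n).1.1)).
  by apply/funext => n; have [] := pP n.
rewrite E in lhs; have := cvg_unique (@norm_hausdorff _ _) lhs rhs.
by rewrite !subr0 scale1r; apply; exact: fmap_proper_filter.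
Unshelve. all: by end_near. Qed.

End equidistant_map.

(** * Blow-ups *)

Section ultrafilter_limits.
Variable R : realType.
Local Notation C := (Rcomplex R).

Lemma cvg_lt_near (T : Type) (F : set_system T) (FF : Filter F)
    (f g : T -> R) (l l' : R) :
  f x @[x --> F] --> l -> g x @[x --> F] --> l' -> l < l' ->
  \forall x \near F, f x < g x.
Proof.
move=> fl gl ll'; near=> x; rewrite -subr_gt0.
near: x; apply: (cvgr_gt (l' - l)); last by rewrite subr_gt0.
exact: cvgB.
Unshelve. all: by end_near. Qed.

Variable U : set_system nat.
Context {UU : UltraFilter U}.

(** The image of an ultrafilter is an ultrafilter, and here it contains a compact segment. *)
Lemma ultra_bounded_cvgR (f : nat -> R) B :
  (\forall n \near U, `|f n| <= B) -> exists l : R, f n @[n --> U] --> l.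
Proof.
move=> fB; have UP : ProperFilter U by exact: ultra_proper.
have fU : UltraFilter (fmap f U).
  split; first exact: fmap_proper_filter.
  move=> G GG sG; apply/seteqP; split => // A GA.
  have [//|UnA] := in_ultra_setVsetC (f @^-1` A) UU.
  have : G (~` A) by apply: sG.
  by move=> /(filterI GA); rewrite setICr => /filter_ex[].
have := @segment_compact R (- B) B; rewrite compact_ultra => /(_ _ fU)[|l [_ fl]].
  by apply: filterS fB => n; rewrite ler_norml /= in_itv.
by exists l.
Qed.

Lemma ultra_bounded_cvg (f : nat -> C) B :
  (\forall n \near U, `|f n| <= B) -> exists l : C, f n @[n --> U] --> l.
Proof.
move=> fB; have UP : ProperFilter U by exact: ultra_proper.
have [a fa] : exists a : R, Re (f n) @[n --> U] --> a.
  apply: (@ultra_bounded_cvgR _ B); apply: filterS fB => n.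
  exact: le_trans (Re_le_norm _).
have [b fb] : exists b : R, Im (f n) @[n --> U] --> b.
  apply: (@ultra_bounded_cvgR _ B); apply: filterS fB => n.
  exact: le_trans (Im_le_norm _).
exists (Complex a b : C); apply/cvgrPdist_lt => eps eps0; near=> n.
apply: (le_lt_trans (norm_le_ReIm _)); rewrite ReCB ImCB /= (splitr eps) ltrD//.
  by near: n; move/cvgrPdist_lt : fa; apply; rewrite divr_gt0.
by near: n; move/cvgrPdist_lt : fb; apply; rewrite divr_gt0.
Unshelve. all: by end_near. Qed.

End ultrafilter_limits.

Section relative_distances.
Variable R : realType.
Local Notation C := (Rcomplex R).
Implicit Types (A : set C) (F : C -> C).

(** Ratios are cross-multiplied, so that coinciding points are allowed. *)
Definition ratio_bound A F (t s : R) := forall a b x, A a -> A b -> A x ->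
  `|a - x| <= t * `|b - x| -> `|F a - F x| <= s * `|F b - F x|.

(* All that is used of quasisymmetry, in a form that passes to inverse maps
   without inverting [eta]. *)
Definition ratio_controlled A F :=
  (forall t, 0 < t -> exists2 s, 0 < s & ratio_bound A F t s) /\
  (forall s, 0 < s -> exists2 t, 0 < t & ratio_bound A F t s).

Definition almost_between (eps : R) (a b c : C) :=
  `|a - b| + `|b - c| <= (1 + eps) * `|a - c|.

Definition infinitesimally_linear A := forall eps, 0 < eps ->
  exists2 delta, 0 < delta & forall a b c, A a -> A b -> A c ->
    `|a - b| < delta -> `|b - c| < delta -> `|c - a| < delta ->
    [\/ almost_between eps a b c, almost_between eps b c a |
        almost_between eps c a b].

Definition meets_small_circles A := exists2 r0, 0 < r0 &
  forall x r, A x -> 0 < r < r0 -> exists2 u, A u & `|u - x| = r.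

Definition almost_equal (eps r s : R) := r <= (1 + eps) * s /\ s <= (1 + eps) * r.

(** [v u x] is the companion of [u] across [x]; it is chosen before [eps], so that one sequence of
    companions serves every precision. Both distances are only almost equal, which suits a map as
    well as its inverse. *)
Definition almost_symmetric A F := exists2 v : C -> C -> C,
  forall u x, A u -> A x -> A (v u x) &
  forall eps, 0 < eps -> exists2 delta, 0 < delta &
    forall u x, A u -> A x -> 0 < `|u - x| < delta ->
    [/\ almost_equal eps `|v u x - x| `|u - x|,
        almost_equal eps `|F (v u x) - F x| `|F u - F x| &
        almost_between eps u x (v u x)].

End relative_distances.

(** * The blow-up limit of a map *)

Section blow_up.
Variable R : realType.
Local Notation C := (Rcomplex R).
Variables (A : set C) (F : C -> C).
Hypothesis F_ratio : ratio_controlled A F.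
Hypothesis A_linear : infinitesimally_linear A.
Hypothesis A_circles : meets_small_circles A.
Hypothesis AF_sym : almost_symmetric A F.
Variable U : set_system nat.
Context {UU : UltraFilter U}.
Variables x v : nat -> C.
Hypothesis Ax : forall n, A (x n).
Hypothesis Av : forall n, A (v n).
Hypothesis vx_gt0 : forall n, 0 < `|v n - x n|.
Hypothesis vx_cvg0 : `|v n - x n| @[n --> U] --> (0 : R).
Hypothesis Fvx_gt0 : forall n, 0 < `|F (v n) - F (x n)|.

Let UP : ProperFilter U. Proof. exact: ultra_proper. Qed.

Let sc (p : nat -> C) n : C := (p n - x n) / (v n - x n).
Let scF (p : nat -> C) n : C := (F (p n) - F (x n)) / (F (v n) - F (x n)).

(* The points [p n] are rescaled so that [x n] and [v n] sit at 0 and 1; their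
   images by [F] are rescaled in the same way, with an independent scale. *)
Definition blows_up_to (p : nat -> C) (z w : C) :=
  [/\ forall n, A (p n), sc p n @[n --> U] --> z & scF p n @[n --> U] --> w].

Let norm_sc p q n : `|sc p n - sc q n| = `|p n - q n| / `|v n - x n|.
Proof. by rewrite -mulrBl normRC_div; congr (`|_| / _); ring. Qed.

Let norm_scF p q n :
  `|scF p n - scF q n| = `|F (p n) - F (q n)| / `|F (v n) - F (x n)|.
Proof. by rewrite -mulrBl normRC_div; congr (`|_| / _); ring. Qed.

Let sc_x n : sc x n = 0. Proof. by rewrite /sc subrr mul0r. Qed.
Let scF_x n : scF x n = 0. Proof. by rewrite /scF subrr mul0r. Qed.

Let sc_v n : sc v n = 1.
Proof. by rewrite /sc divff//; move: (vx_gt0 n); rewrite normr_gt0. Qed.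
Let scF_v n : scF v n = 1.
Proof. by rewrite /scF divff//; move: (Fvx_gt0 n); rewrite normr_gt0. Qed.

Lemma blows_up_base : blows_up_to x 0 0.
Proof.
split=> //; [under eq_cvg do rewrite sc_x|under eq_cvg do rewrite scF_x];
  exact: cvg_cst.
Qed.

Lemma blows_up_unit : blows_up_to v 1 1.
Proof.
split=> //; [under eq_cvg do rewrite sc_v|under eq_cvg do rewrite scF_v];
  exact: cvg_cst.
Qed.

Lemma exists_blow_up p B : (forall n, A (p n)) -> 0 < B ->
  (\forall n \near U, `|p n - x n| <= B * `|v n - x n|) ->
  exists z w, blows_up_to p z w.
Proof.
move=> Ap B0 pB; have [s s0 sP] := F_ratio.1 _ B0.
have [z pz] : exists z : C, sc p n @[n --> U] --> z.
  apply: (@ultra_bounded_cvg _ _ _ _ B); apply: filterS pB => n.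
  by rewrite normRC_div ler_pdivrMr.
have [w pw] : exists w : C, scF p n @[n --> U] --> w.
  apply: (@ultra_bounded_cvg _ _ _ _ s); apply: filterS pB => n.
  by rewrite normRC_div ler_pdivrMr//; exact: sP.
by exists z, w.
Qed.

Let cvg_sc p q z w z' w' : blows_up_to p z w -> blows_up_to q z' w' ->
  `|p n - q n| / `|v n - x n| @[n --> U] --> `|z - z'|.
Proof.
move=> [_ pz _] [_ qz _]; under eq_cvg do rewrite -norm_sc.
by apply: cvg_norm; exact: cvgB.
Qed.

Let cvg_scF p q z w z' w' : blows_up_to p z w -> blows_up_to q z' w' ->
  `|F (p n) - F (q n)| / `|F (v n) - F (x n)| @[n --> U] --> `|w - w'|.
Proof.
move=> [_ _ pw] [_ _ qw]; under eq_cvg do rewrite -norm_scF.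
by apply: cvg_norm; exact: cvgB.
Qed.

(** The strict inequality between limits holds for [U]-almost all [n], where [ratio_bound] applies;
    its conclusion survives in the limit. *)
Lemma blow_up_ratio t s p q r zp wp zq wq zr wr : ratio_bound A F t s ->
  blows_up_to p zp wp -> blows_up_to q zq wq -> blows_up_to r zr wr ->
  `|zp - zr| < t * `|zq - zr| -> `|wp - wr| <= s * `|wq - wr|.
Proof.
move=> ts bp bq br lt_t.
have [[[Ap _ _] [Aq _ _]] [Ar _ _]] := (bp, bq, br).
have c1 := cvg_sc bp br.
have c2 : t * (`|q n - r n| / `|v n - x n|) @[n --> U] --> t * `|zq - zr|.
  by apply: cvgM; [exact: cvg_cst|exact: cvg_sc bq br].
apply: (ler_cvg_to (cvg_scF bp br) (cvgM (cvg_cst s) (cvg_scF bq br))).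
apply: filterS (cvg_lt_near _ c1 c2 lt_t) => n.
rewrite /= mulrA ltr_pM2r ?invr_gt0// => /ltW /(ts _ _ _ (Ap n) (Aq n) (Ar n)).
by move=> le_s; rewrite /cst mulrA ler_pM2r// invr_gt0.
Qed.

Let near_dist p q z w z' w' delta : blows_up_to p z w -> blows_up_to q z' w' ->
  0 < delta -> \forall n \near U, `|p n - q n| < delta.
Proof.
move=> bp bq d0.
have c : `|p n - q n| @[n --> U] --> (0 : R).
  rewrite -(mulr0 `|z - z'|).
  have -> : (fun n => `|p n - q n|) =
      (fun n => `|p n - q n| / `|v n - x n| * `|v n - x n|).
    by apply/funext => n; rewrite divfK// gt_eqF.
  by apply: cvgM => //; exact: cvg_sc bp bq.
exact: (cvgr_lt 0).
Qed.

Let near_ltM (a b : R) : a < b -> \forall eps \near 0^'+, (1 + eps) * a < b.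
Proof.
move=> ab; have c : (1 + eps) * a @[eps --> 0^'+] --> a.
  suff : (1 + eps) * a @[eps --> 0^'+] --> (1 + 0) * a by rewrite addr0 mul1r.
  apply: cvgM; last exact: cvg_cst.
  by apply: cvgD; [exact: cvg_cst|apply: cvg_at_right_filter; exact: cvg_id].
exact: (cvgr_lt a).
Qed.

Let between_limit p q r zp wp zq wq zr wr eps :
  blows_up_to p zp wp -> blows_up_to q zq wq -> blows_up_to r zr wr ->
  (1 + eps) * `|zp - zr| < `|zp - zq| + `|zq - zr| ->
  \forall n \near U, ~ almost_between eps (p n) (q n) (r n).
Proof.
move=> bp bq br lt_eps.
have c1 : (1 + eps) * (`|p n - r n| / `|v n - x n|) @[n --> U] -->
    (1 + eps) * `|zp - zr|.
  by apply: cvgM; [exact: cvg_cst|exact: cvg_sc bp br].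
have c2 : `|p n - q n| / `|v n - x n| + `|q n - r n| / `|v n - x n| @[n --> U] -->
    `|zp - zq| + `|zq - zr|.
  by apply: cvgD; [exact: cvg_sc bp bq|exact: cvg_sc bq br].
apply: filterS (cvg_lt_near _ c1 c2 lt_eps) => n /=.
rewrite mulrA -mulrDl ltr_pM2r ?invr_gt0// => lt_n.
by rewrite /almost_between; apply/negP; rewrite -ltNge.
Qed.

(** If all three triangle inequalities were strict in the limit, they would remain strict up to some
    factor [1 + eps] for [U]-almost all [n], against [A_linear]. *)
Lemma blow_up_linear p q r zp wp zq wq zr wr :
  blows_up_to p zp wp -> blows_up_to q zq wq -> blows_up_to r zr wr ->
  [\/ `|zp - zq| + `|zq - zr| <= `|zp - zr|,
      `|zq - zr| + `|zr - zp| <= `|zq - zp| |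
      `|zr - zp| + `|zp - zq| <= `|zr - zq|].
Proof.
move=> bp bq br.
have [[[Ap _ _] [Aq _ _]] [Ar _ _]] := (bp, bq, br).
have [?|n1] := leP (`|zp - zq| + `|zq - zr|) `|zp - zr|; first exact: Or31.
have [?|n2] := leP (`|zq - zr| + `|zr - zp|) `|zq - zp|; first exact: Or32.
have [?|n3] := leP (`|zr - zp| + `|zp - zq|) `|zr - zq|; first exact: Or33.
exfalso; near (0 : R)^'+ => eps.
have eps0 : 0 < eps by near: eps; exact: nbhs_right_gt.
have [d d0 dP] := A_linear eps0.
near U => n.
have [] : [\/ almost_between eps (p n) (q n) (r n),
    almost_between eps (q n) (r n) (p n) | almost_between eps (r n) (p n) (q n)].
  by apply: dP => //; near: n; apply: near_dist; eassumption.
- near: n; apply: (between_limit bp bq br).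
  by near: eps; exact: near_ltM.
- near: n; apply: (between_limit bq br bp).
  by near: eps; exact: near_ltM.
- near: n; apply: (between_limit br bp bq).
  by near: eps; exact: near_ltM.
Unshelve. all: by end_near. Qed.

Lemma blow_up_real p z w : blows_up_to p z w -> Im z = 0.
Proof.
move=> bp.
have := blow_up_linear blows_up_base blows_up_unit bp.
have norm1 : `|1 : C| = 1.
  by rewrite /Num.norm /= expr1n expr0n addr0 sqrtr1.
rewrite !sub0r !subr0 !normrN !(distrC _ z) norm1 => bet.
have sqr : `|z - 1| ^+ 2 = `|z| ^+ 2 + 1 - 2 * Re z.
  by rewrite !normC_sqr ReCB ImCB /=; ring.
have := normC_sqr z; have := normr_ge0 z; have := normr_ge0 (z - 1).
move: sqr bet; set a := `|z - 1|; set b := `|z|; set c := Re z; set d := Im z.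
move=> sqr bet a0 b0 bE; apply/eqP; rewrite -sqrf_eq0; apply/eqP.
have d0 : 0 <= d ^+ 2 by exact: sqr_ge0.
(* In each case of betweenness for 0, 1 and [z], squaring gives [b <= c] or [b <= - c], that is
   [|z| <= |Re z|]. *)
suff : b ^+ 2 <= c ^+ 2 by lra.
case: bet => bet.
- have : a ^+ 2 <= (b - 1) ^+ 2 by rewrite ler_sqr ?nnegrE//; lra.
  by move=> ab; have bc : b <= c; [lra|nra].
- have : a ^+ 2 <= (1 - b) ^+ 2 by rewrite ler_sqr ?nnegrE//; lra.
  by move=> ab; have bc : b <= c; [lra|nra].
- have : (b + 1) ^+ 2 <= a ^+ 2 by rewrite ler_sqr ?nnegrE//; lra.
  by move=> ab; have bc : b <= - c; [lra|nra].
Qed.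

Let le_mul1eps (a b : R) : (forall eps, 0 < eps -> a <= (1 + eps) * b) -> a <= b.
Proof.
move=> le_ab; rewrite leNgt; apply/negP => /near_ltM lt_eps.
near (0 : R)^'+ => eps.
have : (1 + eps) * b < a by near: eps.
by apply/negP; rewrite -leNgt; apply: le_ab; near: eps; exact: nbhs_right_gt.
Unshelve. all: by end_near. Qed.

Let le_limit eps (f g : nat -> R) (l l' : R) (r : nat -> R) :
  (forall n, 0 < r n) ->
  f n / r n @[n --> U] --> l -> g n / r n @[n --> U] --> l' ->
  (\forall n \near U, f n <= (1 + eps) * g n) -> l <= (1 + eps) * l'.
Proof.
move=> r0 fl gl fg; apply: (ler_cvg_to fl (cvgM (cvg_cst (1 + eps)) gl)).
apply: filterS fg => n fgn; change (f n / r n <= (1 + eps) * (g n / r n)).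
by rewrite mulrA ler_pM2r// invr_gt0.
Qed.

(** [q] consists of the companions of [p n] across [r n]; their relative errors are eventually below
    every [eps], hence vanish in the limit. *)
Lemma blow_up_symmetric p zp wp r zr wr :
  blows_up_to p zp wp -> blows_up_to r zr wr -> zp != zr ->
  exists q zq wq, [/\ blows_up_to q zq wq, `|zq - zr| = `|zp - zr|,
    `|wq - wr| = `|wp - wr| & `|zp - zr| + `|zr - zq| <= `|zp - zq|].
Proof.
move=> bp br zpr; have [sym symA symP] := AF_sym.
have [[Ap pz _] [Ar rz _]] := (bp, br).
pose q n := sym (p n) (r n).
have Aq n : A (q n) by exact: symA.
have near_sym eps : 0 < eps -> \forall n \near U,
    [/\ almost_equal eps `|q n - r n| `|p n - r n|,
        almost_equal eps `|F (q n) - F (r n)| `|F (p n) - F (r n)| &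
        almost_between eps (p n) (r n) (q n)].
  move=> /symP[d d0 dP]; near=> n; apply: dP => //; apply/andP; split.
    rewrite -(pmulr_lgt0 _ (_ : 0 < `|v n - x n|^-1)) ?invr_gt0//.
    near: n; apply: (cvgr_gt _ (cvg_sc bp br)).
    by rewrite normr_gt0 subr_eq0.
  by near: n; exact: near_dist bp br d0.
(* From [|q - x| <= |q - r| + |r - x|] and [|q - r| <= 2 * |p - r|], the case [eps = 1]; each [+ 1]
   leaves room above a limit. *)
pose B := 2 * (`|zp - zr| + 1) + (`|zr - 0| + 1).
have B0 : 0 < B.
  by rewrite addr_gt0// ?mulr_gt0// ltr_pwDr.
have [zq [wq bq]] : exists z w, blows_up_to q z w.
  apply: (exists_blow_up Aq B0); near=> n.
  have [[qr _] _ _] : [/\ almost_equal 1 `|q n - r n| `|p n - r n|,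
      almost_equal 1 `|F (q n) - F (r n)| `|F (p n) - F (r n)| &
      almost_between 1 (p n) (r n) (q n)].
    by near: n; exact: near_sym.
  have pr : `|p n - r n| / `|v n - x n| < `|zp - zr| + 1.
    by near: n; apply: (cvgr_lt _ (cvg_sc bp br)); rewrite ltrDl.
  have rx : `|r n - x n| / `|v n - x n| < `|zr - 0| + 1.
    by near: n; apply: (cvgr_lt _ (cvg_sc br blows_up_base)); rewrite ltrDl.
  move: pr rx; rewrite !ltr_pdivrMr// => pr rx.
  rewrite -(subrK (r n) (q n)) -addrA (le_trans (ler_normD _ _))//.
  rewrite /B [X in _ <= X]mulrDl lerD//; last exact: ltW.
  rewrite (le_trans qr)// -mulrA ler_wpM2l//.
  exact: ltW.
exists q, zq, wq; split => //.
- apply/eqP; rewrite eq_le; apply/andP; split; apply: le_mul1eps => eps eps0.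
    apply: (le_limit vx_gt0 (cvg_sc bq br) (cvg_sc bp br)).
    by apply: filterS (near_sym _ eps0) => n [[]].
  apply: (le_limit vx_gt0 (cvg_sc bp br) (cvg_sc bq br)).
  by apply: filterS (near_sym _ eps0) => n [[]].
- apply/eqP; rewrite eq_le; apply/andP; split; apply: le_mul1eps => eps eps0.
    apply: (le_limit Fvx_gt0 (cvg_scF bq br) (cvg_scF bp br)).
    by apply: filterS (near_sym _ eps0) => n [_ []].
  apply: (le_limit Fvx_gt0 (cvg_scF bp br) (cvg_scF bq br)).
  by apply: filterS (near_sym _ eps0) => n [_ []].
apply: le_mul1eps => eps eps0.
have c : (`|p n - r n| + `|r n - q n|) / `|v n - x n| @[n --> U] -->
    `|zp - zr| + `|zr - zq|.
  under eq_cvg do rewrite mulrDl.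
  by apply: cvgD; [exact: cvg_sc bp br|exact: cvg_sc br bq].
apply: (le_limit vx_gt0 c (cvg_sc bp bq)).
by apply: filterS (near_sym _ eps0) => n [].
Unshelve. all: by end_near. Qed.

(** A third sequence with a limit other than [z] serves as a yardstick: relative to it the distance
    between [p] and [q] is negligible, hence by ratio control so is that between their images. *)
Lemma blow_up_unique p q z wp wq :
  blows_up_to p z wp -> blows_up_to q z wq -> wp = wq.
Proof.
move=> bp bq.
have [r [zr [wr [br zrz]]]] : exists r zr wr, blows_up_to r zr wr /\ zr != z.
  have [->|z0] := eqVneq z 0.
    by exists v, 1, 1; split; [exact: blows_up_unit|exact: oner_neq0].
  by exists x, 0, 0; split; [exact: blows_up_base|rewrite eq_sym].
apply/eqP; rewrite -subr_eq0 -normr_eq0 eq_le normr_ge0 andbT.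
apply/ler_addgt0Pr => eps eps0; rewrite add0r.
have s0 : 0 < eps / (`|wr - wq| + 1) by rewrite divr_gt0// ltr_wpDl.
have [t t0 tP] := F_ratio.2 _ s0.
apply: (le_trans (blow_up_ratio tP bp br bq _)).
  by rewrite subrr normr0 mulr_gt0// normr_gt0 subr_eq0.
rewrite -mulrA ler_piMr ?(ltW eps0)// mulrC ler_pdivrMr ?mul1r ?lerDl//.
Qed.

(** Points on small circles about [x n] have a limit of prescribed modulus, which is real; their
    companions across [x n] give the other sign. *)
Lemma exists_blow_up_real t : exists p w, blows_up_to p (Complex t 0) w.
Proof.
have pos s : 0 < s -> exists p z w, blows_up_to p z w /\ `|z| = s.
  move=> s0; have [r0 r00 rP] := A_circles.
  have /choice[p pP] : forall n, exists u, A u /\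
      (s * `|v n - x n| < r0 -> `|u - x n| = s * `|v n - x n|).
    (* The default [x n] is taken only when the circle is too large, hence for [U]-almost no [n]. *)
    move=> n; have [sr|sr] := ltP (s * `|v n - x n|) r0; last by exists (x n).
    have [|u Au ux] := rP (x n) (s * `|v n - x n|) (Ax n); last by exists u.
    by rewrite mulr_gt0.
  have near_p : \forall n \near U, `|p n - x n| = s * `|v n - x n|.
    have c : s * `|v n - x n| @[n --> U] --> s * 0.
      by apply: cvgM => //; exact: cvg_cst.
    apply: filterS (cvgr_lt _ c r0 _); last by rewrite mulr0.
    by move=> n; exact: (pP n).2.
  have [||z [w bp]] := @exists_blow_up p s _ s0.
  - by move=> n; exact: (pP n).1.
  - by apply: filterS near_p => n ->.
  exists p, z, w; split=> //; rewrite -[z]subr0.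
  apply: (cvg_unique (@norm_hausdorff _ _) (cvg_sc bp blows_up_base)).
  apply: cvg_near_cst; apply: filterS near_p => n ->.
  by rewrite mulfK// gt_eqF.
have both s : 0 < s -> (exists p w, blows_up_to p (Complex s 0) w) /\
    (exists p w, blows_up_to p (Complex (- s) 0) w).
  move=> s0; have [p [z [w [bp zs]]]] := pos s s0.
  have z0 : z != 0 by rewrite -normr_gt0 zs.
  have [q [z' [w' [bq]]]] := blow_up_symmetric bp blows_up_base z0.
  rewrite !subr0 sub0r normrN => zz' _ bet.
  have real_abs u wu pu : blows_up_to pu u wu -> `|u| = s ->
      u = Complex s 0 \/ u = Complex (- s) 0.
    move=> bu us; have iu := blow_up_real bu.
    have /eqP : Re u ^+ 2 = s ^+ 2 by rewrite -us normC_sqr iu expr0n addr0.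
    rewrite eqf_sqr => /orP[] /eqP uE; [left|right];
      by apply: eq_ReIm; rewrite ?uE ?iu.
  have zneq : z != z'.
    apply/eqP => zE; move: bet; rewrite -zE subrr normr0 zs leNgt.
    by rewrite addr_gt0.
  have [] := real_abs _ _ _ bp zs; have [] := real_abs _ _ _ bq (etrans zz' zs).
  - by move=> E1 E2; rewrite E1 E2 eqxx in zneq.
  - move=> E1 E2; rewrite {}E2 in bp; rewrite {}E1 in bq.
    by split; [exists p, w|exists q, w'].
  - move=> E1 E2; rewrite {}E2 in bp; rewrite {}E1 in bq.
    by split; [exists q, w'|exists p, w].
  - by move=> E1 E2; rewrite E1 E2 eqxx in zneq.
have [t0|t0|->] := ltrgtP t 0.
- by have [_] := both (- t) ltac:(rewrite oppr_gt0 //); rewrite opprK.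
- by have [] := both t t0.
- by exists x, 0; exact: blows_up_base.
Qed.

(** The limits of images define a map [H] on the real line, single-valued by [blow_up_unique]. It
    meets the hypotheses of [equidistant_map_affine] and fixes 0 and 1, so it is the inclusion. *)
Lemma blow_up_isometric p z w : blows_up_to p z w -> `|w| = `|z|.
Proof.
move=> bp.
have /choice[H HP] : forall t, exists w, exists q, blows_up_to q (Complex t 0) w.
  by move=> t; have [q [u bq]] := exists_blow_up_real t; exists u, q.
have HE t q u : blows_up_to q (Complex t 0) u -> H t = u.
  by have [q' bq'] := HP t; exact: (blow_up_unique bq').
have H0 : H 0 = 0 by exact: HE blows_up_base.
have H1 : H 1 = 1 by exact: HE blows_up_unit.
have dist_real a b : `|(Complex a 0 : C) - Complex b 0| = `|a - b|.
  by rewrite {1}/Num.norm /= subrr expr0n addr0 sqrtr_sqr.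
have H_ratio t s a b y : ratio_bound A F t s -> `|a - y| < t * `|b - y| ->
    `|H a - H y| <= s * `|H b - H y|.
  move=> ts ab; have [[qa ba] [qb bb] [qy by_]] := And3 (HP a) (HP b) (HP y).
  by apply: (blow_up_ratio ts ba bb by_); rewrite !dist_real.
have H_neq a b : a != b -> H a != H b.
  move=> ab; apply/eqP => Hab.
  have ba0 : 0 < `|a - b| by rewrite normr_gt0 subr_eq0.
  (* If two distinct points had the same image, ratio control would make [H] constant, against
     [H 0 = 0] and [H 1 = 1]. *)
  have Hc c : H c = H b.
    have t0 : 0 < (`|c - b| + 1) / `|a - b| by rewrite divr_gt0// ltr_wpDl.
    have [s _ sP] := F_ratio.1 _ t0; apply/eqP; rewrite -subr_eq0 -normr_le0.
    apply: (le_trans (H_ratio _ _ c a b sP _)).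
      by rewrite divfK ?gt_eqF// ltrDl.
    by rewrite Hab subrr normr0 mulr0.
  by have := oner_neq0 C; rewrite -H1 -H0 (Hc 1) (Hc 0) eqxx.
have H_equi y s : `|H (y + s) - H y| = `|H y - H (y - s)|.
  have [->|s0] := eqVneq s 0; first by rewrite addr0 subr0 subrr.
  have [[qp b1] [qr b2]] := (HP (y + s), HP y).
  have [|q [zq [wq [bq]]]] := blow_up_symmetric b1 b2.
    by rewrite -subr_eq0 -normr_eq0 dist_real addrAC subrr add0r normr_eq0.
  have zqE : zq = Complex (Re zq) 0.
    by apply: eq_ReIm => //=; exact: blow_up_real bq.
  rewrite zqE !dist_real in bq *; move: (Re zq) bq => r bq {zqE zq}.
  rewrite [y + s - y]addrAC subrr add0r => rs ws bet.
  (* The companion lies at distance [|s|] from [y]; it is not [y + s], because [y] is between the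
     two. *)
  have rE : r = y - s.
    have : `|r - y| ^+ 2 = `|s| ^+ 2 by rewrite rs.
    rewrite !real_normK ?num_real// => /eqP; rewrite eqf_sqr => /orP[] /eqP E.
      have {}E : r = y + s by lra.
      move: bet; rewrite E subrr normr0 leNgt.
      by rewrite ltr_pwDl// normr_gt0.
    by lra.
  by rewrite rE in bq; rewrite (HE _ _ _ bq) -ws distrC.
have H_cont : continuous H.
  move=> y; have FF : Filter (nbhs y) by exact: nbhs_filter.
  apply/(@cvgrPdist_le _ _ _ (nbhs y)) => eps eps0.
  pose D := `|H (y + 1) - H y| + 1.
  have D0 : 0 < D by rewrite ltr_wpDl.
  have [t t0 tP] := F_ratio.2 _ (divr_gt0 eps0 D0).
  apply/nbhs_ballP; exists t => //= u yu.
  rewrite distrC; apply: (le_trans (H_ratio _ _ u (y + 1) y tP _)).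
    by rewrite addrAC subrr add0r normr1 mulr1 distrC.
  by rewrite -mulrA ler_piMr ?(ltW eps0)// mulrC ler_pdivrMr// mul1r lerDl.
have H_unbounded y s B : 0 < s -> exists n : nat, B < `|H (y + s *+ n) - H y|.
  move=> s0; pose d := `|H (y + s) - H y|.
  have d0 : 0 < d.
    by rewrite normr_gt0 subr_eq0 H_neq// -subr_eq0 addrAC subrr add0r gt_eqF.
  have B0 : 0 < `|B| + 1 by rewrite ltr_wpDl.
  (* For [n] above [t^-1], one step is shorter than [t] times [n] steps, so [d] is at most the
     fraction [d / (|B| + 1)] of the distance reached after [n] steps. *)
  have [t t0 tP] := F_ratio.2 _ (divr_gt0 d0 B0).
  pose n := (Num.trunc t^-1).+1; exists n.
  have : d <= d / (`|B| + 1) * `|H (y + s *+ n) - H y|.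
    apply: (H_ratio _ _ (y + s) (y + s *+ n) y tP).
    rewrite [y + s - y]addrAC [y + s *+ n - y]addrAC subrr !add0r.
    rewrite normrMn -mulr_natr mulrCA -[X in X < _]mulr1 ltr_pM2l ?normr_gt0 ?gt_eqF//.
    rewrite mulrC -ltr_pdivrMr// mul1r.
    by have /andP[] := truncn_itv (ltW (eq_ind_r _ t0 (invr_gt0 t))).
  rewrite -mulrA -[X in X <= _]mulr1 ler_pM2l// mulrC ler_pdivlMr// mul1r.
  by apply: lt_le_trans; rewrite ltr_pwDr// ler_norm.
have zE : z = Complex (Re z) 0.
  by apply: eq_ReIm => //=; exact: blow_up_real bp.
have H_inj : injective H.
  by move=> a b Hab; apply/eqP; apply: contraT => /H_neq; rewrite Hab eqxx.
have := equidistant_map_affine H_equi H_inj H_cont H_unbounded (Re z).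
rewrite H0 H1 !subr0; rewrite zE in bp *; rewrite (HE _ _ _ bp) => ->.
by congr (`|_|); apply: eq_ReIm; rewrite /= ?mulr1 ?mulr0.
Qed.

End blow_up.

Section asymptotic_similarity.
Variable R : realType.
Local Notation C := (Rcomplex R).
Variables (A : set C) (F : C -> C).

(* Blow up along an ultrafilter a sequence of hypothetical counterexamples. *)
Lemma asymptotic_similarity (eps M : R) : ratio_controlled A F ->
  infinitesimally_linear A -> meets_small_circles A -> almost_symmetric A F ->
  0 < eps -> 0 < M -> exists2 delta, 0 < delta &
    forall u v x, A u -> A v -> A x -> 0 < `|v - x| < delta ->
    `|u - x| <= M * `|v - x| -> `|v - x| <= M * `|u - x| ->
    `|F u - F x| * `|v - x| <= (1 + eps) * (`|F v - F x| * `|u - x|).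
Proof.
move=> F_ratio A_lin A_circ AF_sym eps0 M0; apply: contrapT => no_delta.
have /choice[p pP] : forall n : nat, exists p : C * C * C,
    [/\ [/\ A p.1.1, A p.1.2 & A p.2], 0 < `|p.1.2 - p.2| < n.+1%:R^-1,
      `|p.1.1 - p.2| <= M * `|p.1.2 - p.2|,
      `|p.1.2 - p.2| <= M * `|p.1.1 - p.2| &
      (1 + eps) * (`|F p.1.2 - F p.2| * `|p.1.1 - p.2|) <
        `|F p.1.1 - F p.2| * `|p.1.2 - p.2|].
  move=> n; apply: contrapT => no_p; apply: no_delta.
  exists n.+1%:R^-1; first by rewrite invr_gt0.
  move=> u v x Au Av Ax vx ux xu; rewrite leNgt; apply/negP => bad.
  by apply: no_p; exists (u, v, x).
pose u n := (p n).1.1; pose v n := (p n).1.2; pose x n := (p n).2.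
have Au n : A (u n) by have [[]] := pP n.
have Av n : A (v n) by have [[]] := pP n.
have Ax n : A (x n) by have [[]] := pP n.
have vx0 n : 0 < `|v n - x n| by have [_ /andP[]] := pP n.
have ux n : `|u n - x n| <= M * `|v n - x n| by have [] := pP n.
have xu n : `|v n - x n| <= M * `|u n - x n| by have [] := pP n.
have bad n : (1 + eps) * (`|F (v n) - F (x n)| * `|u n - x n|) <
  `|F (u n) - F (x n)| * `|v n - x n| by have [] := pP n.
have Fvx0 n : 0 < `|F (v n) - F (x n)|.
  rewrite lt_neqAle normr_ge0 andbT eq_sym; apply/eqP => Fvx.
  have [s _ sP] := F_ratio.1 _ M0.
  have := sP _ _ _ (Au n) (Av n) (Ax n) (ux n).
  rewrite Fvx mulr0 => Fux; have := bad n; rewrite Fvx mul0r mulr0.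
  by rewrite ltNge mulr_le0_ge0.
have [U [UU subU]] := ultraFilterLemma (@eventually_filter : ProperFilter \oo).
have UP : ProperFilter U by exact: ultra_proper.
have vx_cvg : `|v n - x n| @[n --> U] --> (0 : R).
  apply/cvgrPdist_lt => e e0; apply: subU.
  near=> n; rewrite sub0r normrN normr_id.
  have [_ /andP[_ /lt_trans lt_n] _ _ _] := pP n; apply: lt_n.
  by near: n; exact: near_infty_natSinv_lt (PosNum e0).
have [|z [w bu]] := @exists_blow_up _ _ _ F_ratio _ UU x v Ax Av vx0 Fvx0 u _ Au M0.
  by near=> n.
have wz : `|w| = `|z|.
  exact: (@blow_up_isometric _ A F F_ratio A_lin A_circ AF_sym U UU x v Ax Av
    vx0 vx_cvg Fvx0 _ _ _ bu).
have [_ cz cw] := bu.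
have {}cz : `|(u n - x n) / (v n - x n) : C| @[n --> U] --> `|z|.
  exact: cvg_norm.
have {}cw : `|(F (u n) - F (x n)) / (F (v n) - F (x n)) : C| @[n --> U] --> `|w|.
  exact: cvg_norm.
(* Since [z] is nonzero, the factor [1 + eps] of [bad] survives in the limit and contradicts
   [|w| = |z|]. *)
have z_gt : M^-1 <= `|z|.
  apply: (cvgr_to_ge cz); near=> n.
  by rewrite normRC_div ler_pdivlMr// ler_pdivrMl.
have : (1 + eps) * `|z| <= `|w|.
  apply: (ler_cvg_to (cvgM (cvg_cst (1 + eps)) cz) cw); near=> n.
  change ((1 + eps) * `|(u n - x n) / (v n - x n) : C| <=
    `|(F (u n) - F (x n)) / (F (v n) - F (x n)) : C|).
  rewrite !normRC_div ler_pdivlMr// mulrA mulrAC ler_pdivrMr//.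
  by rewrite -mulrA [_ * `|F _ - _|]mulrC ltW.
rewrite wz ger_pMl; last by rewrite (lt_le_trans _ z_gt)// invr_gt0.
by rewrite gerDl leNgt eps0.
Unshelve. all: by end_near. Qed.

End asymptotic_similarity.

(** * Simple loops and their subarcs *)

Section loops.
Variable R : realType.
Local Notation C := (Rcomplex R).

(** A Jordan curve, parametrized periodically by the line so that around every point there is an
    interval of parameters. *)
Definition simple_loop (T : R) (Phi : R -> C) := [/\ 0 < T, continuous Phi,
  forall t, Phi (t + T) = Phi t & forall t d, 0 < d < T -> Phi (t + d) <> Phi t].

Section simple_loop_theory.
Variables (T : R) (Phi : R -> C).
Hypothesis loopP : simple_loop T Phi.

Let T_gt0 : 0 < T. Proof. by case: loopP. Qed.
Let Phi_cont : continuous Phi. Proof. by case: loopP. Qed.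
Let Phi_per t : Phi (t + T) = Phi t. Proof. by case: loopP. Qed.

Let Phi_perz t k : Phi (t + T *~ k) = Phi t.
Proof.
have pern n u : Phi (u + T *+ n) = Phi u.
  by elim: n u => [|n IH] u; rewrite ?addr0// mulrS addrA IH.
case: k => n; first exact: pern.
by rewrite -(pern n.+1) NegzE mulrNz subrK.
Qed.

Lemma loop_inj s t : Phi s = Phi t -> `|s - t| < T -> s = t.
Proof.
have [_ _ _ inj] := loopP.
move=> st; rewrite ltr_norml => /andP[lo hi].
have [lt_st|lt_ts|//] := ltrgtP s t.
  have [] := inj s (t - s); first by lra.
  by rewrite addrC subrK.
have [] := inj t (s - t); first by lra.
by rewrite addrC subrK.
Qed.

Let shift_into (a t : R) : exists k : int, a <= t + T *~ k < a + T.
Proof.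
exists (- Num.floor ((t - a) / T)).
have := floor_itv ((t - a) / T); rewrite ler_pdivlMr// ltr_pdivrMr//.
set q := Num.floor _; rewrite mulrNz -(mulrzr T) intrD mulrDl mulr1z mul1r ![_ * T]mulrC.
by move=> /andP[]; set z := T * _ => *; apply/andP; split; lra.
Qed.

(** Counterexamples can be shifted into one period, where they converge along an ultrafilter to a
    common parameter. *)
Lemma loop_uniform_continuous eps : 0 < eps -> exists2 kappa, 0 < kappa &
  forall s t, `|s - t| < kappa -> `|Phi s - Phi t| < eps.
Proof.
move=> eps0; apply: contrapT => no_kappa.
have /choice[p pP] : forall n : nat, exists p : R * R, [/\ 0 <= p.1 < 0 + T,
    `|p.1 - p.2| < n.+1%:R^-1 & eps <= `|Phi p.1 - Phi p.2|].
  move=> n; apply: contrapT => no_p; apply: no_kappa.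
  exists n.+1%:R^-1; first by rewrite invr_gt0.
  move=> s t st; rewrite ltNge; apply/negP => far; apply: no_p.
  have [k kP] := shift_into 0 s.
  exists (s + T *~ k, t + T *~ k); rewrite /= !Phi_perz; split => //.
  by rewrite [s + _]addrC [t + _]addrC opprD addrACA subrr add0r.
have [U [UU subU]] := ultraFilterLemma (@eventually_filter : ProperFilter \oo).
have UP : ProperFilter U by exact: ultra_proper.
have [|l cl] := @ultra_bounded_cvgR R U UU (fun n => (p n).1) T.
  near=> n; have [/andP[p0 pT] _ _] := pP n.
  by rewrite ger0_norm// ltW//; rewrite add0r in pT.
have cl' : (p n).2 @[n --> U] --> l.
  apply/cvgrPdist_lt => e e0; near=> n.
  rewrite -(subrK (p n).1 l) -addrA (splitr e) (le_lt_trans (ler_normD _ _))//.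
  apply: ltrD.
    by near: n; move/cvgrPdist_lt : cl; apply; rewrite divr_gt0.
  have [_ + _] := pP n; move=> /lt_trans; apply.
  near: n; apply: subU; apply: (near_infty_natSinv_lt (PosNum _)).
  by rewrite divr_gt0.
have c : `|Phi (p n).1 - Phi (p n).2| @[n --> U] --> `|Phi l - Phi l|.
  apply: cvg_norm; apply: cvgB; [apply: (cvg_comp _ _ cl)|apply: (cvg_comp _ _ cl')];
    exact: Phi_cont.
have : eps <= `|Phi l - Phi l|.
  by apply: (cvgr_to_ge c); near=> n; have [] := pP n.
by rewrite subrr normr0 leNgt eps0.
Unshelve. all: by end_near. Qed.

(** Otherwise some pairs of parameters, differing by between [kappa] and [T - kappa], have images
    closer and closer; their limit contradicts injectivity modulo [T]. *)
Lemma loop_inverse_uniform kappa : 0 < kappa -> exists2 r, 0 < r &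
  forall s t, `|Phi s - Phi t| < r -> exists2 t', Phi t' = Phi t & `|s - t'| < kappa.
Proof.
move=> kappa0; apply: contrapT => no_r.
have /choice[p pP] : forall n : nat, exists p : R * R, [/\ 0 <= p.1 < 0 + T,
    kappa <= p.2 <= T - kappa & `|Phi p.1 - Phi (p.1 + p.2)| < n.+1%:R^-1].
  move=> n; apply: contrapT => no_p; apply: no_r.
  exists n.+1%:R^-1; first by rewrite invr_gt0.
  move=> s t st; apply: contrapT => far.
  have [k kP] := shift_into 0 s; have [m mP] := shift_into s t.
  apply: no_p; exists (s + T *~ k, t + T *~ m - s).
  have far_from t' : Phi t' = Phi t -> kappa <= `|s - t'|.
    by move=> t't; rewrite leNgt; apply/negP => ?; apply: far; exists t'.
  have f1 := far_from (t + T *~ m) (Phi_perz _ _).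
  have f2 : kappa <= `|s - (t + T *~ m - T)|.
    by apply: far_from; rewrite -[LHS]Phi_per subrK Phi_perz.
  split => //=.
    move: f1 f2 mP; set z := t + _ => f1 f2 /andP[m1 m2].
    rewrite distrC ger0_norm ?subr_ge0// in f1.
    rewrite ger0_norm in f2; last by lra.
    by apply/andP; split; lra.
  have -> : s + T *~ k + (t + T *~ m - s) = t + T *~ m + T *~ k by ring.
  by rewrite !Phi_perz.
have [U [UU subU]] := ultraFilterLemma (@eventually_filter : ProperFilter \oo).
have UP : ProperFilter U by exact: ultra_proper.
have [|l cl] := @ultra_bounded_cvgR R U UU (fun n => (p n).1) T.
  near=> n; have [/andP[p0 pT] _ _] := pP n.
  by rewrite ger0_norm// ltW//; rewrite add0r in pT.
have [|d cd] := @ultra_bounded_cvgR R U UU (fun n => (p n).2) T.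
  near=> n; have [_ /andP[p0 pT] _] := pP n.
  by rewrite ger0_norm//; lra.
have c : `|Phi (p n).1 - Phi ((p n).1 + (p n).2)| @[n --> U] -->
    `|Phi l - Phi (l + d)|.
  apply: cvg_norm; apply: cvgB; first by apply: (cvg_comp _ _ cl); exact: Phi_cont.
  by apply: (cvg_comp _ _ (cvgD cl cd)); exact: Phi_cont.
have dk : kappa <= d by apply: (cvgr_to_ge cd); near=> n; have [_ /andP[]] := pP n.
have dT : d <= T - kappa.
  by apply: (cvgr_to_le cd); near=> n; have [_ /andP[]] := pP n.
have : `|Phi l - Phi (l + d)| <= 0.
  apply/ler_addgt0Pr => e e0; rewrite add0r; apply: (cvgr_to_le c); near=> n.
  have [_ _ /ltW /le_trans] := pP n; apply; apply: ltW.
  by near: n; apply: subU; exact: (near_infty_natSinv_lt (PosNum e0)).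
rewrite normr_le0 subr_eq0 => /eqP E.
have := @loop_inj l (l + d) E; rewrite opprD addrA subrr add0r normrN.
rewrite ger0_norm; last by lra.
have dltT : d < T by lra.
by move=> /(_ dltT); lra.
Unshelve. all: by end_near. Qed.

Definition loop_arc a b : set C := Phi @` `[a, b].

Let arc_closed a b : closed (loop_arc a b).
Proof.
apply: compact_closed; first exact: norm_hausdorff.
apply: continuous_compact; last exact: segment_compact.
exact: continuous_subspaceT.
Qed.

Lemma arc_sub_range a b : loop_arc a b `<=` range Phi.
Proof. by move=> _ [t _ <-]; exists t. Qed.

Let range_arcs (a b : R) : a <= b -> b <= a + T ->
  range Phi `<=` loop_arc a b `|` loop_arc b (a + T).
Proof.
move=> ab bT _ [t _ <-]; have [k /andP[k1 k2]] := shift_into a t.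
have [tb|/ltW bt] := leP (t + T *~ k) b; [left|right];
  by exists (t + T *~ k); rewrite ?Phi_perz //= in_itv /= ?k1 ?tb ?bt ?(ltW k2).
Qed.

(* The two arcs cut out by points [Phi p] and [Phi q] outside [E] separate
   [Phi a] from [Phi b] in [E]. *)
Lemma connected_contains_arc (a b : R) (E : set C) : a < b < a + T ->
  connected E -> E `<=` range Phi -> E (Phi a) -> E (Phi b) ->
  loop_arc a b `<=` E \/ loop_arc b (a + T) `<=` E.
Proof.
move=> /andP[ab bT] E_conn E_range Ea Eb.
apply: contrapT => /not_orP[/existsNP[_ /not_implyP[[p p_itv <-] nEp]]].
move=> /existsNP[_ /not_implyP[[q q_itv <-] nEq]].
move: p_itv q_itv; rewrite /= !in_itv /= => /andP[ap pb] /andP[bq qT].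
have {}ap : a < p.
  by rewrite lt_neqAle ap andbT; apply/eqP => E0; apply: nEp; rewrite -E0.
have {}pb : p < b.
  by rewrite lt_neqAle pb andbT; apply/eqP => E0; apply: nEp; rewrite E0.
have {}bq : b < q.
  by rewrite lt_neqAle bq andbT; apply/eqP => E0; apply: nEq; rewrite -E0.
have {}qT : q < a + T.
  by rewrite lt_neqAle qT andbT; apply/eqP => E0; apply: nEq; rewrite E0 Phi_per.
have disj z : E z -> loop_arc p q z -> ~ loop_arc q (p + T) z.
  move=> Ez [s /= s_itv sz] [t /= t_itv tz].
  move: s_itv t_itv; rewrite !in_itv /= => /andP[s1 s2] /andP[t1 t2].
  have [E0|Tts] := eqVneq t (s + T).
    have sp : s = p by lra.
    by apply: nEp; rewrite -sp sz.
  have st : s = t.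
    apply: loop_inj; first by rewrite sz tz.
    have tsT : t < s + T by rewrite lt_neqAle Tts; lra.
    by rewrite ltr_norml; apply/andP; split; lra.
  have sq : s = q by lra.
  by apply: nEq; rewrite -sq sz.
have cover z : E z -> loop_arc p q z \/ loop_arc q (p + T) z.
  by move=> /E_range /(@range_arcs p q); apply; lra.
(* The two arcs meet only at [Phi p] and [Phi q], outside [E]; so this part of [E] is clopen in [E],
   and it contains [Phi b] but not [Phi a]. *)
have : E `&` loop_arc p q = E.
  apply: E_conn.
  - by exists (Phi b); split => //; exists b; rewrite //= in_itv /=; lra.
  - exists (~` loop_arc q (p + T)); first exact/closed_openC/arc_closed.
    apply/seteqP; split=> z [Ez zpq]; split => //; first exact: disj.
    by have [] := cover _ Ez.
  - by exists (loop_arc p q); first exact: arc_closed.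
move=> /seteqP[_ /(_ _ Ea) [_ [s /= +]]]; rewrite in_itv /= => /andP[s1 s2] sa.
have := loop_inj sa; rewrite ger0_norm; last by lra.
have saT : s - a < T by lra.
by move=> /(_ saT); lra.
Qed.

Lemma loop_arc_subarc (a b : R) : a < b < a + T ->
  subarc (range Phi) (Phi a) (Phi b) (loop_arc a b).
Proof.
move=> /andP[ab bT]; split; first exact: arc_sub_range.
have ba0 : 0 < b - a by rewrite subr_gt0.
pose gamma (u : R) := Phi (a + u * (b - a)).
have gammaE : gamma @` `[0, 1] = loop_arc a b.
  apply/seteqP; split=> _ [u /= + <-]; rewrite in_itv /= => /andP[u0 u1].
    exists (a + u * (b - a)) => //=; rewrite in_itv /=; apply/andP; split.
      by rewrite lerDl mulr_ge0// ltW.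
    by rewrite -lerBrDl ler_piMl// ltW.
  exists ((u - a) / (b - a)); last by rewrite /gamma divfK ?gt_eqF// addrC subrK.
  rewrite /= in_itv /=; apply/andP; split.
    by rewrite divr_ge0 ?subr_ge0// ltW.
  by rewrite ler_pdivrMr// mul1r lerB.
exists gamma; split; last 2 first.
- by rewrite /gamma mul0r addr0.
- by rewrite /gamma mul1r addrC subrK.
split=> //.
have gamma_cont : continuous gamma.
  move=> u; have c : {for u, continuous (fun r : R => a + r * (b - a))}.
    apply: continuousD; first exact: cvg_cst.
    by apply: continuousM; [exact: cvg_id|exact: cvg_cst].
  exact: (continuous_comp c (@Phi_cont _)).
have /choice[g gP] : forall z, exists u, loop_arc a b z -> 0 <= u <= 1 /\ gamma u = z.
  move=> z; have [[u]|nz] := pselect ((gamma @` `[0, 1]) z); last first.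
    by exists 0; rewrite -gammaE.
  by rewrite /= in_itv /= => u01 uz; exists u.
have inv_unif e : 0 < e -> exists2 r, 0 < r & forall u w, 0 <= u <= 1 ->
    0 <= w <= 1 -> `|gamma u - gamma w| < r -> `|u - w| < e.
  move=> e0.
  (* The first bound is the precision sought, rescaled by [b - a]; the second keeps [t'] within one
     period of the parameter of [gamma w], so that the two agree. *)
  have k0 : 0 < Num.min (e * (b - a)) (T - (b - a)).
    by rewrite lt_min mulr_gt0//=; lra.
  have [r r0 rP] := loop_inverse_uniform k0.
  exists r => // u w /andP[u0 u1] /andP[w0 w1] /rP[t' t'E].
  rewrite lt_min => /andP[ut1 ut2].
  have tE : t' = a + w * (b - a).
    apply: loop_inj => //.
    rewrite -(subrK (a + u * (b - a)) t') -addrA.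
    rewrite (le_lt_trans (ler_normD _ _))// [`|t' - _|]distrC.
    have : `|a + u * (b - a) - (a + w * (b - a))| <= b - a.
      have -> : a + u * (b - a) - (a + w * (b - a)) = (u - w) * (b - a) by ring.
      rewrite normrM (ger0_norm (ltW ba0)) ler_piMl ?(ltW ba0)//.
      by rewrite ler_norml; apply/andP; split; lra.
    by lra.
  move: ut1; rewrite tE.
  have -> : a + u * (b - a) - (a + w * (b - a)) = (u - w) * (b - a) by ring.
  by rewrite normrM (ger0_norm (ltW ba0)) ltr_pM2r.
exists g; split; first exact: continuous_subspaceT.
  rewrite gammaE; apply/subspace_continuousP => z az.
  apply/cvgrPdist_lt => e e0; have [r r0 rP] := inv_unif e e0.
  rewrite /within /=; apply/nbhs_ballP; exists r => //= w zw aw.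
  have [g1 g2] := gP _ az; have [g3 g4] := gP _ aw.
  by apply: rP => //; rewrite g2 g4.
move=> u; rewrite inE /= in_itv /= => u01.
have au : loop_arc a b (gamma u) by rewrite -gammaE; exists u; rewrite //= in_itv.
have [g1 g2] := gP _ au; apply/eqP; rewrite -subr_eq0 -normr_le0.
apply/ler_addgt0Pr => e e0; rewrite add0r; have [r r0 rP] := inv_unif e e0.
by apply/ltW/rP => //; rewrite g2 subrr normr0.
Qed.

(** A competing subarc is connected, so it contains this arc or the complementary one. The latter
    contains the points at [a + T / 4] and [a + T / 2], whose distance is no less than the diameter
    of a short arc. *)
Lemma short_arcs_minor : exists2 kappa, 0 < kappa & forall a b,
  a < b < a + kappa -> minor_subarc (range Phi) (Phi a) (Phi b) (loop_arc a b).
Proof.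
have T8 : 0 < T / 8 by rewrite divr_gt0.
have [r r0 rP] := loop_inverse_uniform T8.
have [k k0 kP] := loop_uniform_continuous r0.
exists (Num.min k (T / 4)); first by rewrite lt_min k0 divr_gt0.
move=> a b /andP[ab]; rewrite -ltrBlDl lt_min => /andP[bk bT4].
have abT : a < b < a + T by rewrite ab /=; lra.
split; first exact: loop_arc_subarc.
move=> E [E_range [gamma [[[g [gamma_cont _ _]] gammaE] g0 g1]]].
have E_conn : connected E.
  rewrite -gammaE; apply: connected_continuous_connected gamma_cont.
  exact: segment_connected.
have Ea : E (Phi a) by rewrite -gammaE -g0; exists 0; rewrite //= in_itv /= lexx ler01.
have Eb : E (Phi b) by rewrite -gammaE -g1; exists 1; rewrite //= in_itv /= lexx ler01.
have mono (E1 E2 : set C) : E1 `<=` E2 -> (diam E1 <= diam E2)%E.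
  by move=> E12; apply: ereal_sup_le => _ [p [p1 p2] <-]; exists p => //; split;
    exact: E12.
have [sub|sub] := connected_contains_arc abT E_conn E_range Ea Eb; first exact: mono.
apply: le_trans (mono _ _ sub); apply: (@le_trans _ _ r%:E).
  apply: ge_ereal_sup => _ [[z w] [/= [s s_itv <-] [t t_itv <-]] <-].
  move: s_itv t_itv; rewrite /= !in_itv /= => /andP[s1 s2] /andP[t1 t2].
  rewrite lee_fin; apply/ltW/kP; rewrite ltr_norml; apply/andP; split; lra.
apply: (@le_trans _ _ (mdist (Phi (a + T / 4)) (Phi (a + T / 2)))%:E).
  rewrite lee_fin leNgt; apply/negP => /rP[t t2].
  have /(_ t (a + T / 2) t2) := @loop_inj.
  rewrite !ltr_norml => inj /andP[l1 l2].
  have : t = a + T / 2 by apply: inj; apply/andP; split; lra.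
  lra.
apply: ereal_sup_ubound; exists (Phi (a + T / 4), Phi (a + T / 2)) => //.
by split; [exists (a + T / 4)|exists (a + T / 2)] => //=; rewrite in_itv /=;
  apply/andP; split; lra.
Qed.

End simple_loop_theory.
End loops.

(** * Betweenness and small circles on a loop *)

Section loop_geometry.
Variable R : realType.
Local Notation C := (Rcomplex R).

Lemma mdistC_norm (z w : C) : mdist z w = `|z - w|.
Proof. by []. Qed.

Lemma cvg_at_right0_lt (f : R -> \bar R) (l eps : R) :
  f r @[r --> (0 : R)^'+] --> l%:E -> 0 < eps ->
  exists2 r, 0 < r & (f r < (l + eps)%:E)%E.
Proof.
move=> fl eps0.
have lt_l : (l%:E < (l + eps)%:E)%E by rewrite lte_fin ltrDl.
have fl_lt := fl _ (open_ereal_lt' lt_l).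
near (0 : R)^'+ => r; exists r; first by near: r; exact: nbhs_right_gt.
by near: r; exact: fl_lt.
Unshelve. all: by end_near. Qed.

Section one_loop.
Variables (T : R) (Phi : R -> C).
Hypothesis loopP : simple_loop T Phi.

Let T_gt0 : 0 < T. Proof. by case: loopP. Qed.
Let Phi_cont : continuous Phi. Proof. by case: loopP. Qed.

(** Short parameter intervals give minor subarcs, so the conformality defect bounds the excess in
    the triangle inequality. *)
Lemma loop_almost_between eps : asymptotically_conformal (range Phi) -> 0 < eps ->
  exists2 kappa, 0 < kappa & forall a t b, a <= t -> t <= b -> b < a + kappa ->
    almost_between eps (Phi a) (Phi t) (Phi b).
Proof.
move=> ac eps0; have [r r0] := cvg_at_right0_lt ac eps0; rewrite add0r => defect.
have [k1 k10 minor] := short_arcs_minor loopP.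
have [k2 k20 unif] := loop_uniform_continuous loopP r0.
exists (Num.min (Num.min k1 k2) T); first by rewrite !lt_min k10 k20.
move=> a t b at_ tb; rewrite -ltrBlDl !lt_min => /andP[/andP[bk1 bk2] bT].
have [ab|ba] := ltP a b; last first.
  have -> : t = a by lra.
  have -> : b = a by lra.
  by rewrite /almost_between subrr normr0 addr0 mulr0.
have Phi_ab : 0 < `|Phi a - Phi b|.
  rewrite normr_gt0 subr_eq0; apply/eqP => E.
  have := loop_inj loopP E; rewrite distrC gtr0_norm ?subr_gt0// => /(_ bT).
  by lra.
have : (((`|Phi a - Phi t| + `|Phi t - Phi b|) / `|Phi a - Phi b| - 1)%:E <= eps%:E)%E.
  apply: le_trans (ltW defect).
  pose S : \bar R := ereal_sup [set ((mdist (Phi a) w + mdist w (Phi b)) /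
      mdist (Phi a) (Phi b) - 1)%:E | w in loop_arc Phi a b].
  apply: (@le_trans _ _ S).
    apply: ereal_sup_ubound; exists (Phi t) => //.
    by exists t; rewrite //= in_itv /= at_ tb.
  apply: ereal_sup_ubound; exists (Phi a), (Phi b), (loop_arc Phi a b); split => //.
  - rewrite mdistC_norm Phi_ab /= ltW// unif// distrC gtr0_norm ?subr_gt0//.
  - by apply: minor; rewrite ab -ltrBlDl.
by rewrite lee_fin lerBlDl ler_pdivrMr.
Qed.

(** Three close points lift to close parameters; the one in the middle on the line is almost between
    the others. *)
Lemma loop_infinitesimally_linear :
  asymptotically_conformal (range Phi) -> infinitesimally_linear (range Phi).
Proof.
move=> ac eps eps0; have [k k0 kP] := loop_almost_between ac eps0.
have k2 : 0 < k / 2 by rewrite divr_gt0.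
have [d d0 dP] := loop_inverse_uniform loopP k2.
exists d => // _ _ _ [a _ <-] [b0 _ <-] [c0 _ <-] /dP[b <-] ab_lt _.
rewrite distrC => /dP[c <-] ac_lt.
move: ab_lt ac_lt; rewrite !ltr_norml => /andP[b1 b2] /andP[c1 c2].
have rev x y z : almost_between eps x y z -> almost_between eps z y x.
  by rewrite /almost_between addrC ![`|x - _|]distrC (distrC y z).
have bet x y z : x <= y -> y <= z -> z < x + k ->
  almost_between eps (Phi x) (Phi y) (Phi z) by exact: kP.
have [ab|/ltW ba] := leP a b; have [bc|/ltW cb] := leP b c;
  have [ac'|/ltW ca] := leP a c.
- by apply: Or31; apply: bet => //; lra.
- by apply: Or31; apply: bet => //; lra.
- by apply: Or32; apply/rev; apply: bet => //; lra.
- by apply: Or33; apply: bet => //; lra.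
- by apply: Or33; apply/rev; apply: bet => //; lra.
- by apply: Or32; apply: bet => //; lra.
- by apply: Or31; apply/rev; apply: bet => //; lra.
- by apply: Or31; apply/rev; apply: bet => //; lra.
Qed.

(** With [r0] half the distance between [Phi 0] and [Phi (T / 2)], one of these two is at least [r0]
    away from any given point; the intermediate value theorem concludes. *)
Lemma loop_meets_small_circles : meets_small_circles (range Phi).
Proof.
have T0 : 0 < T by exact: T_gt0.
pose r0 := `|Phi 0 - Phi (T / 2)| / 2.
have dist0 : 0 < `|Phi 0 - Phi (T / 2)|.
  rewrite normr_gt0 subr_eq0; apply/eqP => E.
  have := loop_inj loopP E; rewrite sub0r normrN gtr0_norm ?divr_gt0// => inj.
  by have : 0 = T / 2; [apply: inj; lra|lra].
exists r0; first by rewrite divr_gt0.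
move=> _ r [t _ <-] /andP[r_gt0 rr0].
have cont : continuous (fun s => `|Phi s - Phi t|).
  move=> s; apply: cvg_norm; apply: cvgB; [exact: Phi_cont|exact: cvg_cst].
have [s rs] : exists s, r <= `|Phi s - Phi t|.
  have [?|lt1] := leP r `|Phi 0 - Phi t|; first by exists 0.
  exists (T / 2); rewrite leNgt; apply/negP => lt2.
  have := ler_distD (Phi t) (Phi 0) (Phi (T / 2)); rewrite (distrC (Phi t)).
  by rewrite /r0 in rr0; lra.
have ivt a b : a <= b -> Num.min `|Phi a - Phi t| `|Phi b - Phi t| <= r <=
    Num.max `|Phi a - Phi t| `|Phi b - Phi t| ->
    exists2 u, range Phi u & `|u - Phi t| = r.
  move=> ab rP.
  have [||c _ cr] := @IVT _ (fun s => `|Phi s - Phi t|) a b r ab => //.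
    exact: continuous_subspaceT.
  by exists (Phi c) => //; exists c.
have [ts|/ltW st] := leP t s.
  by apply: (ivt t s ts); rewrite subrr normr0 ge_min le_max rs (ltW r_gt0) orbT.
by apply: (ivt s t st); rewrite subrr normr0 ge_min le_max rs (ltW r_gt0) orbT.
Qed.

(** [sgn] is 1 or -1 and selects a side of [a]. The distance to [Phi a] takes the value [r] on the
    parameter range [[0, T / 4]], and inverse continuity puts that parameter below [kappa]. *)
Lemma loop_both_sides kappa : 0 < kappa -> exists2 delta, 0 < delta &
  forall a r sgn, 0 < r < delta -> `|sgn| = 1 ->
    exists2 s, 0 < s < kappa & `|Phi (a + sgn * s) - Phi a| = r.
Proof.
move=> kappa0; have T0 : 0 < T by exact: T_gt0.
have k0 : 0 < Num.min kappa (T / 8) by rewrite lt_min kappa0 divr_gt0.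
have [d d0 dP] := loop_inverse_uniform loopP k0.
have near_a a u : `|u| <= T / 4 -> `|Phi (a + u) - Phi a| < d ->
    `|u| < kappa /\ `|u| < T / 8.
  move=> uT /dP[t tE]; rewrite lt_min => /andP[l1 l2].
  have ta : t = a.
    apply: (loop_inj loopP tE); rewrite -(subrK (a + u) t) -addrA.
    rewrite (le_lt_trans (ler_normD _ _))// [`|t - _|]distrC
      [a + u - a]addrAC subrr add0r.
    by lra.
  by move: l1 l2; rewrite ta [a + u - a]addrAC subrr add0r.
exists d => // a r sgn /andP[r0 rd] sgn1.
have cont : continuous (fun s => `|Phi (a + sgn * s) - Phi a|).
  move=> s; apply: cvg_norm; apply: cvgB; last exact: cvg_cst.
  have c : {for s, continuous (fun s => a + sgn * s)}.
    apply: continuousD; first exact: cvg_cst.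
    by apply: continuousM; [exact: cvg_cst|exact: cvg_id].
  exact: (continuous_comp c (@Phi_cont _)).
have norm_sgn s : 0 <= s -> `|sgn * s| = s.
  by move=> s0; rewrite normrM sgn1 mul1r ger0_norm.
have far : d <= `|Phi (a + sgn * (T / 4)) - Phi a|.
  rewrite leNgt; apply/negP => /near_a.
  by rewrite norm_sgn ?divr_ge0 ?(ltW T0)// lexx => /(_ isT)[_]; lra.
have [|||s] := @IVT _ (fun s => `|Phi (a + sgn * s) - Phi a|) 0 (T / 4) r.
- by rewrite divr_ge0 ?(ltW T0).
- exact: continuous_subspaceT.
- by rewrite mulr0 addr0 subrr normr0 ge_min le_max (ltW r0) (le_trans (ltW rd) far) orbT.
rewrite in_itv /= => /andP[s0 sT] sr; exists s => //.
have sn0 : s != 0.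
  by apply: contraTneq r0 => E; rewrite -sr E mulr0 addr0 subrr normr0 ltxx.
rewrite lt_neqAle eq_sym sn0 s0 /=.
have [] := near_a a (sgn * s); rewrite ?norm_sgn//.
by rewrite sr.
Qed.

End one_loop.

End loop_geometry.

(** * Equidistant points on both sides *)

Section opposite_points.
Variable R : realType.
Local Notation C := (Rcomplex R).
Variables (T : R) (Phi : R -> C).
Hypothesis loopP : simple_loop T Phi.

(** The order of the parameters says that [u] and [w] lie on opposite sides of [x]. *)
Definition equidistant_along (u x w : C) (kappa : R) := exists m a z : R,
  [/\ Phi m = u, Phi a = x, Phi z = w & `|w - x| = `|u - x|] /\
  [/\ `|m - a| < kappa, `|z - a| < kappa & m < a < z \/ z < a < m].

(** The companion is chosen once, at parameter scale [T / 8]. Small distances then make the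
    parameters [kappa]-close for any [kappa], because [Phi a] has no second parameter that near. *)
Lemma opposite_points : exists2 v : C -> C -> C,
  forall u x, range Phi u -> range Phi x -> range Phi (v u x) &
  forall kappa, 0 < kappa -> exists2 delta, 0 < delta & forall u x,
    range Phi u -> range Phi x -> 0 < `|u - x| < delta ->
    equidistant_along u x (v u x) kappa.
Proof.
have T0 : 0 < T by case: loopP.
have T8 : 0 < T / 8 by rewrite divr_gt0.
have [d1 d10 sides] := loop_both_sides loopP T8.
have [d2 d20 inv] := loop_inverse_uniform loopP T8.
have /choice[v vP] : forall p : C * C, exists w,
    range Phi p.1 -> range Phi p.2 -> range Phi w /\
    (0 < `|p.1 - p.2| < Num.min d1 d2 -> equidistant_along p.1 p.2 w (T / 8)).
  move=> [u x]; have [close|far] := boolP (0 < `|u - x| < Num.min d1 d2); last first.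
    by exists x => _ Ax; split.
  have [[m0 _ m0E]|] := pselect (range Phi u); last by exists x.
  have [[a _ aE]|] := pselect (range Phi x); last by exists x.
  move: close; rewrite lt_min => /and3P[ux0 ux1 ux2].
  have [|m mE am] := inv a m0; first by rewrite m0E aE distrC.
  rewrite m0E in mE; have rP : 0 < `|u - x| < d1 by rewrite ux0.
  have uxE : `|u - x| <> 0 by move=> E; rewrite E ltxx in ux0.
  have [lt_ma|lt_am|ma] := ltrgtP m a; last by rewrite -mE -aE ma subrr normr0 in uxE.
    have [s /andP[s0 sT] sr] := sides a _ 1 rP (normr1 _).
    rewrite mul1r aE in sr; exists (Phi (a + s)) => _ _; split; first by exists (a + s).
    move=> _; exists m, a, (a + s); split; first by split.
    rewrite distrC [a + s - a]addrAC subrr add0r [`|s|]gtr0_norm//; split => //.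
    by left; rewrite lt_ma ltrDl.
  have [s /andP[s0 sT] sr] := sides a _ (-1) rP (normrN1 _).
  rewrite mulN1r aE in sr; exists (Phi (a - s)) => _ _; split; first by exists (a - s).
  move=> _; exists m, a, (a - s); split; first by split.
  rewrite distrC [a - s - a]addrAC subrr add0r normrN [`|s|]gtr0_norm//; split => //.
  by right; rewrite lt_am gtrBl s0.
exists (fun u x => v (u, x)).
  by move=> u x Au Ax; exact: (vP (u, x) Au Ax).1.
move=> k k0; have k80 : 0 < Num.min k (T / 8) by rewrite lt_min k0.
have [d3 d30 inv3] := loop_inverse_uniform loopP k80.
exists (Num.min d3 (Num.min d1 d2)); first by rewrite !lt_min d30 d10.
move=> u x Au Ax; rewrite lt_min => /and3P[ux0 ux3 ux12].
have [_ /(_ _)[|m [a [z [[mE aE zE wx] [ma za sd]]]]]] := vP (u, x) Au Ax.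
  by rewrite /= ux0.
rewrite /= in mE aE zE wx.
exists m, a, z; split; first by split.
have close y : `|y - a| < T / 8 -> `|Phi y - Phi a| < d3 -> `|y - a| < k.
  move=> ya /inv3[t tE]; rewrite lt_min => /andP[tk tT].
  suff <- : t = a by [].
  apply: (loop_inj loopP tE); rewrite -(subrK y t) -addrA.
  by rewrite (le_lt_trans (ler_normD _ _))// distrC; lra.
split => //; apply: close => //; first by rewrite mE aE.
by rewrite zE aE wx.
Qed.

End opposite_points.

(** * Almost symmetry from equidistant distortion *)

Section symmetry.
Variable R : realType.
Local Notation C := (Rcomplex R).

Definition asymptotically_equidistant (A : set C) (F : C -> C) :=
  forall eps, 0 < eps -> exists2 delta, 0 < delta & forall a b x, A a -> A b -> A x ->
    `|a - x| = `|b - x| -> `|a - x| < delta -> `|F a - F x| <= (1 + eps) * `|F b - F x|.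

Variables (T : R) (Phi : R -> C).
Hypothesis loopP : simple_loop T Phi.

(** [psi] is [Phi] or [h \o Phi], whichever traces the asymptotically conformal curve: companions
    are found by distances on the source, and the order of parameters carries over to the target. *)
Let along_between eps u x w (psi : R -> C) (kappa : R) :
  (forall a t b, a <= t -> t <= b -> b < a + kappa ->
    almost_between eps (psi a) (psi t) (psi b)) ->
  equidistant_along Phi u x w (kappa / 2) -> exists m a z,
  [/\ Phi m = u, Phi a = x, Phi z = w & almost_between eps (psi m) (psi a) (psi z)].
Proof.
move=> bet [m [a [z [[mE aE zE _] [ma za sd]]]]].
exists m, a, z; split=> //; move: ma za; rewrite !ltr_norml.
move=> /andP[l1 l2] /andP[l3 l4].
case: sd => /andP[s1 s2]; first by apply: bet; [exact: ltW|exact: ltW|lra].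
rewrite /almost_between addrC ![`|psi m - _|]distrC (distrC (psi a) (psi z)).
by apply: bet; [exact: ltW|exact: ltW|lra].
Qed.

Lemma almost_symmetric_source F : asymptotically_conformal (range Phi) ->
  asymptotically_equidistant (range Phi) F -> almost_symmetric (range Phi) F.
Proof.
move=> ac equi; have [v vA vP] := opposite_points loopP.
exists v => // eps eps0.
have [k k0 kP] := loop_almost_between loopP ac eps0.
have [d1 d10 d1P] := vP (k / 2) (divr_gt0 k0 (ltr0Sn _ 1)).
have [d2 d20 d2P] := equi _ eps0.
exists (Num.min d1 d2); first by rewrite lt_min d10.
move=> u x Au Ax; rewrite lt_min => /and3P[ux0 ux1 ux2].
have along := d1P u x Au Ax (introT andP (conj ux0 ux1)).
have wx : `|v u x - x| = `|u - x| by have [m [a [z [[_ _ _ ->]]]]] := along.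
have Av := vA _ _ Au Ax.
split.
- by split; rewrite wx ler_peMl// lerDl ltW.
- by split; apply: d2P; rewrite ?wx.
by have [m [a [z [<- <- <-]]]] := along_between kP along.
Qed.

Variables h k : C -> C.
Hypothesis hK : {in range Phi, cancel h k}.
Hypothesis h_loopP : simple_loop T (h \o Phi).

Let hKP t : k (h (Phi t)) = Phi t.
Proof. by apply: hK; rewrite inE; exists t. Qed.

(** Companions are taken on the source and carried over by [h]. Hence their images under [k] are
    exactly equidistant, and [equi] makes the distances on the target almost equal. *)
Lemma almost_symmetric_target : asymptotically_conformal (range (h \o Phi)) ->
  asymptotically_equidistant (range Phi) h -> almost_symmetric (range (h \o Phi)) k.
Proof.
move=> ac equi; have [v vA vP] := opposite_points loopP.
have vk u x : range (h \o Phi) u -> range (h \o Phi) x ->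
    range Phi (v (k u) (k x)).
  move=> [s _ <-] [t _ <-]; rewrite /= !hKP; apply: vA; by [exists s|exists t].
exists (fun u x => h (v (k u) (k x))).
  by move=> u x Au Ax; have [t _ <-] := vk _ _ Au Ax; exists t.
move=> eps eps0.
have [kap kap0 kapP] := loop_almost_between h_loopP ac eps0.
have [d1 d10 d1P] := vP (kap / 2) (divr_gt0 kap0 (ltr0Sn _ 1)).
have [d2 d20 d2P] := equi _ eps0.
have d0 : 0 < Num.min d1 d2 by rewrite lt_min d10.
(* Close points of the target have close parameters, hence close preimages. *)
have [e e0 eP] := loop_uniform_continuous loopP d0.
have [d d'0 dP] := loop_inverse_uniform h_loopP e0.
exists d => // _ _ [s _ <-] [t _ <-] /andP[ux0 ux].
have [t' t'E st'] := dP _ _ ux.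
have PE : Phi t' = Phi t by rewrite -hKP -[h _]/((h \o Phi) _) t'E hKP.
have := eP _ _ st'; rewrite PE lt_min => /andP[ux1 ux2].
have ux0' : 0 < `|Phi s - Phi t|.
  rewrite normr_gt0 subr_eq0; apply/eqP => E.
  by move: ux0; rewrite /= E subrr normr0 ltxx.
have As : range Phi (Phi s) by exists s.
have At : range Phi (Phi t) by exists t.
have along := d1P _ _ As At (introT andP (conj ux0' ux1)).
rewrite /= !hKP; set w := v (Phi s) (Phi t) in along *.
have Aw : range Phi w by exact: vA.
have kw : k (h w) = w by have [r _ <-] := Aw; exact: hKP.
have wx : `|w - Phi t| = `|Phi s - Phi t| by have [m [a [z [[_ _ _ ->]]]]] := along.
rewrite kw wx; split.
- by split; apply: d2P; rewrite ?wx.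
- by split; rewrite ler_peMl// lerDl ltW.
by have [m [a [z [/= <- <- <-]]]] := along_between kapP along.
Qed.

End symmetry.

(** * Jordan curves as simple loops *)

Section circle_loops.
Variable R : realType.
Local Notation C := (Rcomplex R).

Lemma simple_loop_comp T (Phi : R -> C) (h : C -> C) : simple_loop T Phi ->
  {within range Phi, continuous h} -> {in range Phi &, injective h} ->
  simple_loop T (h \o Phi).
Proof.
move=> [T0 Phi_cont per inj] h_cont h_inj; split => //.
- move=> t; have /subspace_continuousP h_cont' := h_cont.
  have At : range Phi (Phi t) by exists t.
  have c : Phi s @[s --> t] --> within (range Phi) (nbhs (Phi t)).
    move=> P /(@Phi_cont t) nP.
    have {}nP : \forall s \near t, range Phi (Phi s) -> P (Phi s) by exact: nP.
    by apply: filterS nP => s; apply; exists s.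
  exact: (cvg_comp _ _ c (h_cont' _ At)).
- by move=> t; rewrite /= per.
- by move=> t d dT /h_inj E; apply: (inj t d dT); apply: E;
    rewrite inE; [exists (t + d)|exists t].
Qed.

Definition circle_point (t : R) : C := Complex (cos t) (sin t).

Lemma range_circle_point : range circle_point = @unit_circle R.
Proof.
apply/seteqP; split => [_ [t _ <-]|z z1].
  by rewrite /unit_circle /= /Num.norm /= cos2Dsin2 sqrtr1.
have z2 : Re z ^+ 2 + Im z ^+ 2 = 1 by rewrite -normC_sqr z1 expr1n.
have Re1 : -1 <= Re z <= 1.
  by rewrite -ler_norml -z1 Re_le_norm.
have sqrt_Im : Num.sqrt (1 - Re z ^+ 2) = `|Im z|.
  by rewrite -z2 addrAC subrr add0r sqrtr_sqr.
have [Im0|Im0] := leP 0 (Im z).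
  exists (acos (Re z)) => //; apply: eq_ReIm => /=.
    by rewrite acosK// in_itv.
  by rewrite sin_acos// sqrt_Im ger0_norm.
exists (- acos (Re z)) => //; apply: eq_ReIm => /=.
  by rewrite cosN acosK// in_itv.
by rewrite sinN sin_acos// sqrt_Im ltr0_norm// opprK.
Qed.

Lemma simple_loop_circle : simple_loop (pi *+ 2) circle_point.
Proof.
split.
- by rewrite pmulrn_lgt0// pi_gt0.
- move=> t; apply/cvgrPdist_lt => e e0; near=> s.
  rewrite (le_lt_trans (norm_le_ReIm _))// ReCB ImCB /= (splitr e) ltrD//.
    near: s; have := @continuous_cos R t => /cvgrPdist_lt; apply.
    by rewrite divr_gt0.
  near: s; have := @continuous_sin R t => /cvgrPdist_lt; apply.
  by rewrite divr_gt0.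
- by move=> t; rewrite /circle_point cosD2pi sinD2pi.
- move=> t d /andP[d0 dpi] [ceq seq].
  (* Equal points give [cos d = 1], that is [sin (d / 2) = 0], although [d / 2] lies strictly
     between 0 and [pi]. *)
  have : cos (t + d - t) = 1.
    by rewrite cosB ceq seq -!expr2 cos2Dsin2.
  rewrite addrAC subrr add0r [d in cos d](splitr d) cosD -!expr2 cos2sin2.
  have : 0 < sin (d / 2).
    apply: sin_gt0_pi; rewrite divr_gt0//= ltr_pdivrMr//.
    by rewrite mulr_natr.
  by nra.
Unshelve. all: by end_near. Qed.

Lemma jordan_curve_loop (Gamma : set C) : jordan_curve Gamma ->
  exists T Phi, simple_loop T Phi /\ range Phi = Gamma.
Proof.
move=> [f [[g [f_cont _ fK]] fG]]; exists (pi *+ 2), (f \o circle_point); split.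
  apply: simple_loop_comp; first exact: simple_loop_circle.
    by rewrite range_circle_point.
  by rewrite range_circle_point; exact: can_in_inj fK.
by rewrite -fG -range_circle_point image_comp.
Qed.

End circle_loops.

(** * Ratio control for quasisymmetric maps and their inverses *)

Section metric_conditions.
Variable R : realType.
Local Notation C := (Rcomplex R).
Implicit Types (A : set C) (h k : C -> C).

Lemma quasisymmetric_ratio_controlled A h :
  quasisymmetric A h -> ratio_controlled A h.
Proof.
move=> [[g [_ _ hK]] [eta [[eg [eta_cont _ _]] eta_surj] qs]].
have h_inj a b : A a -> A b -> h a = h b -> a = b.
  by move=> Aa Ab; apply: (can_in_inj hK); rewrite inE.
have key t s a b x : 0 <= t -> 0 <= s -> eta t <= s -> A a -> A b -> A x ->
    a != b -> `|a - x| <= t * `|b - x| -> `|h a - h x| <= s * `|h b - h x|.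
  move=> t0 s0 etas Aa Ab Ax ab ax_le.
  have [->|ax] := eqVneq a x; first by rewrite subrr normr0 mulr_ge0.
  have [bx|bx] := eqVneq b x.
    move: ax_le; rewrite bx subrr normr0 mulr0 normr_le0 subr_eq0.
    by rewrite (negbTE ax).
  have uniq3 : uniq [:: a; b; x] by rewrite /= !inE negb_or ab ax bx.
  have bx0 : 0 < `|b - x| by rewrite normr_gt0 subr_eq0.
  have hbx0 : 0 < `|h b - h x|.
    rewrite normr_gt0 subr_eq0; apply/eqP => /(h_inj _ _ Ab Ax) E.
    by rewrite E eqxx in bx.
  have := qs a b x t Aa Ab Ax uniq3 t0; rewrite !mdistC_norm !ler_pdivrMr//.
  by move=> /(_ ax_le) /le_trans; apply; rewrite ler_pM2r.
split.
  (* The bound 1 covers the case [a = b], about which quasisymmetry says nothing. *)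
  move=> t t0; exists (Num.max (eta t) 1); first by rewrite lt_max ltr01 orbT.
  move=> a b x Aa Ab Ax ax_le.
  have [->|ab] := eqVneq a b; first by rewrite ler_peMl// le_max lexx orbT.
  by apply: (key t) => //; rewrite ?le_max ?ler01 ?lexx ?orbT// ltW.
move=> s s0.
(* By surjectivity [eta] vanishes somewhere. A positive zero serves directly; if the zero is 0,
   continuity there gives a suitable [t]. *)
have [t t0 etat] : exists2 t, 0 < t & eta t <= s.
  have : (eta @` `[0, +oo[) 0 by rewrite eta_surj /= in_itv /= lexx.
  move=> [t1 /= + eta_t1]; rewrite in_itv /= andbT le_eqVlt => /orP[/eqP t10|t10].
    have /subspace_continuousP /(_ 0) := eta_cont.
    rewrite /= in_itv /= lexx => /(_ isT) /cvgrPdist_lt /(_ _ s0).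
    move=> /nbhs_ballP[e /= e0 eP].
    exists (e / 2); first by rewrite divr_gt0.
    have e2 : 0 < e / 2 by rewrite divr_gt0.
    have : `|eta 0 - eta (e / 2)| < s.
      apply: eP; last by rewrite /= in_itv /= ltW.
      by rewrite /ball /= sub0r normrN gtr0_norm// ltr_pdivrMr// ltr_pMr// ltr1n.
    by rewrite t10 eta_t1 sub0r normrN => /ltW; apply: le_trans; exact: ler_norm.
  by exists t1 => //; rewrite eta_t1 ltW.
exists (Num.min t (1 / 2)); first by rewrite lt_min t0 divr_gt0.
move=> a b x Aa Ab Ax ax_le.
have [E|ab] := eqVneq a b; last first.
  apply: (key t) => //; [exact: ltW|exact: ltW|].
  by rewrite (le_trans ax_le)// ler_wpM2r// ge_min lexx.
have bx : b = x.
  apply/eqP; rewrite -subr_eq0 -normr_eq0; apply: contraTT ax_le => bx.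
  rewrite -ltNge E gtr_pMl; first by rewrite gt_min; apply/orP; right; lra.
  by rewrite lt_neqAle eq_sym bx normr_ge0.
by rewrite E bx subrr normr0 mulr0.
Qed.

(** A large ratio of preimages has a small inverse, so [h] bounds the inverse ratio of images by
    [s]; with [t' * s < 1] this contradicts the bound [t'] on that ratio. *)
Lemma ratio_controlled_inverse A h k : {in A, cancel h k} ->
  ratio_controlled A h -> ratio_controlled (h @` A) k.
Proof.
move=> hK [h1 h2].
have hKP a : A a -> k (h a) = a by move=> Aa; apply: hK; rewrite inE.
have inv t s : 0 < t -> 0 < s -> forall t', t' * s < 1 -> ratio_bound A h t s ->
    ratio_bound (h @` A) k t' t^-1.
  move=> t0 s0 t' ts hts _ _ _ [a Aa <-] [b Ab <-] [x Ax <-]; rewrite !hKP// => le_t'.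
  rewrite mulrC ler_pdivlMr// mulrC leNgt; apply/negP => lt_t.
  have le1 := hts b a x Ab Aa Ax (ltW lt_t).
  have hb0 : `|h b - h x| = 0.
    apply/eqP; rewrite eq_le normr_ge0 andbT leNgt; apply/negP => hb0.
    have : `|h b - h x| <= s * (t' * `|h b - h x|).
      by rewrite (le_trans le1)// ler_pM2l.
    by rewrite mulrA -[X in X <= _]mul1r ler_pM2r// leNgt mulrC ts.
  move: hb0 => /eqP; rewrite normr_eq0 subr_eq0 => /eqP /(congr1 k).
  rewrite !hKP// => bx; move: le_t'; rewrite bx subrr normr0 mulr0 normr_le0.
  rewrite subr_eq0 => /eqP /(congr1 k); rewrite !hKP// => ax.
  by move: lt_t; rewrite ax bx subrr normr0 mulr0 ltxx.
split.
  move=> t' t'0; have s0 : 0 < (2 * t')^-1 by rewrite invr_gt0 mulr_gt0.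
  have [t t0 tP] := h2 _ s0; exists t^-1; first by rewrite invr_gt0.
  apply: (inv t _ t0 s0) => //.
  by rewrite invfM mulrC -mulrA mulVf ?gt_eqF// mulr1 invf_lt1// ltr1n.
move=> s' s'0; have t0 : 0 < s'^-1 by rewrite invr_gt0.
have [s s0 sP] := h1 _ t0; exists (2 * s)^-1; first by rewrite invr_gt0 mulr_gt0.
rewrite -[s']invrK; apply: (inv _ s t0 s0) => //.
by rewrite invfM -mulrA mulVf ?gt_eqF// mulr1 invf_lt1// ltr1n.
Qed.

End metric_conditions.

(** * Equivalence of the symmetry conditions *)

Section asymptotic_symmetry.
Variable R : realType.
Local Notation C := (Rcomplex R).
Implicit Types (A : set C) (h k : C -> C).

(** In cross-multiplied form: ratios between [1 / M] and [M] are preserved up to a factor [1 + eps].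
    The opposite estimate comes from exchanging [u] and [v]. *)
Definition asymptotically_similar A h := forall eps M : R, 0 < eps -> 0 < M ->
  exists2 delta, 0 < delta & forall u v x, A u -> A v -> A x ->
    0 < `|v - x| < delta -> `|u - x| <= M * `|v - x| -> `|v - x| <= M * `|u - x| ->
    `|h u - h x| * `|v - x| <= (1 + eps) * (`|h v - h x| * `|u - x|).

Lemma le_diam (E : set C) z w : E z -> E w -> (`|z - w|%:E <= diam E)%E.
Proof. by move=> Ez Ew; apply: ereal_sup_ubound; exists (z, w). Qed.

Lemma diam_triple_le (a b x : C) r : `|a - x| <= r -> `|b - x| <= r ->
  (diam [set a; b; x] <= (2 * r)%:E)%E.
Proof.
move=> ar br; have r0 : 0 <= r by exact: le_trans ar.
have near_x z : [set a; b; x] z -> `|z - x| <= r.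
  by move=> [[]|] -> //; rewrite subrr normr0.
apply: ge_ereal_sup => _ [[z w] [/= zE wE] <-]; rewrite lee_fin mdistC_norm.
rewrite mulr_natl mulr2n (le_trans (ler_distD x _ _))// lerD// ?near_x//.
by rewrite distrC near_x.
Qed.

Lemma equidistant_weak_asymptotic A h : {in A &, injective h} ->
  equidistant_weakly_asymptotically_symmetric A h -> asymptotically_equidistant A h.
Proof.
move=> h_inj ewas eps eps0.
have [r r0 distortion] := cvg_at_right0_lt ewas eps0.
(* The diameter of the triple is at most twice the common distance to [x]. *)
exists (r / 2); first by rewrite divr_gt0.
move=> a b x Aa Ab Ax ab ar.
have [->|ax] := eqVneq a x; first by rewrite subrr normr0 mulr_ge0// addr_ge0// ltW.
have ax0 : 0 < `|a - x| by rewrite normr_gt0 subr_eq0.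
have hbx0 : 0 < `|h b - h x|.
  rewrite normr_gt0 subr_eq0; apply/eqP => E.
  have bx : b = x by apply: h_inj; rewrite ?inE.
  by rewrite ab bx subrr normr0 ltxx in ax0.
have : ((Num.max (`|h a - h x| / `|h b - h x|) (`|h b - h x| / `|h a - h x|))%:E
    <= equidistant_distortion A h r)%E.
  apply: ereal_sup_ubound; exists a, b, x; split => //; split => //.
  apply/andP; split.
    have : (`|a - x|%:E <= diam [set a; b; x])%E.
      by apply: le_diam; [left; left|right].
    by apply: lt_le_trans; rewrite lte_fin.
  rewrite (le_trans (diam_triple_le (ltW ar) _)) ?lee_fin//; last by lra.
  by rewrite -ab ltW.
move=> /le_lt_trans /(_ distortion); rewrite lte_fin gt_max => /andP[+ _].
by rewrite ltr_pdivrMr// => /ltW.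
Qed.

(** The upper bound is the weak condition for [(a, b)] and [(b, a)]. The lower bound 1 comes from a
    degenerate triple [u, u, x] with [|u - x| = r]; small circles supply it, so the supremum is not
    [-oo]. *)
Lemma weak_equidistant_weak A h : {in A &, injective h} -> A !=set0 ->
  meets_small_circles A -> weakly_asymptotically_symmetric A h ->
  equidistant_weakly_asymptotically_symmetric A h.
Proof.
move=> h_inj [x Ax] [r0 r00 circles] was P [/= e e0 eP].
have e2 : 0 < e / 2 by rewrite divr_gt0.
have [d d0 dP] := was _ e2.
suff : \forall r \near (0 : R)^'+, P (equidistant_distortion A h r) by [].
near=> r.
have r_gt0 : 0 < r by near: r; exact: nbhs_right_gt.
have rr0 : r < r0 by near: r; exact: nbhs_right_lt.
have rd : r <= d by near: r; exact: nbhs_right_le.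
have ge1 : (1%:E <= equidistant_distortion A h r)%E.
  have [|u Au ur] := circles x r Ax; first by rewrite r_gt0.
  apply: ereal_sup_ubound; exists u, u, x; split => //; split => //.
    apply/andP; split.
      have : (`|u - x|%:E <= diam [set u; u; x])%E.
        by apply: le_diam; [left; left|right].
      by apply: lt_le_trans; rewrite lte_fin ur.
    apply: ge_ereal_sup => _ [[z w] [/= zE wE] <-]; rewrite lee_fin mdistC_norm.
    have [[|]|] := zE => ->; have [[|]|] := wE => ->;
      by rewrite ?subrr ?normr0 ?(distrC x) ?ur// ltW.
  rewrite !mdistC_norm maxxx divff// normr_eq0 subr_eq0.
  apply/eqP => /(h_inj _ _); rewrite !inE => /(_ Au Ax) E.
  by move: r_gt0; rewrite -ur E subrr normr0 ltxx.
have le1 : (equidistant_distortion A h r <= (1 + e / 2)%:E)%E.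
  apply: ge_ereal_sup => _ [a [b [y [[Aa Ab Ay] [ab /andP[diam0 diam_r] ->]]]]].
  rewrite !mdistC_norm in ab *.
  have ay : `|a - y| != 0.
    apply: contraTneq diam0 => ay0; have aE : a = y.
      by apply/eqP; rewrite -subr_eq0 -normr_eq0 ay0.
    have bE : b = y by apply/eqP; rewrite -subr_eq0 -normr_eq0 -ab ay0.
    rewrite -leNgt aE bE; apply: ge_ereal_sup => _ [[z w] [/= zE wE] <-].
    have [[|]|] := zE => ->; have [[|]|] := wE => ->;
      by rewrite mdistC_norm subrr normr0.
  have ay' : a != y by rewrite -subr_eq0 -normr_eq0.
  have by' : b != y by rewrite -subr_eq0 -normr_eq0 -ab.
  have diam_d : (diam [set a; b; y] <= d%:E)%E.
    by rewrite (le_trans diam_r)// lee_fin.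
  have diam_d' : (diam [set b; a; y] <= d%:E)%E.
    by rewrite (_ : [set b; a; y] = [set a; b; y])//; congr (_ `|` _); exact: setUC.
  rewrite lee_fin ge_max; have [->|ab'] := eqVneq a b.
    rewrite divff ?lerDl ?(ltW e2)// normr_eq0 subr_eq0; apply/eqP => E.
    by have := h_inj _ _ (mem_set Ab) (mem_set Ay) E; apply/eqP.
  apply/andP; split; rewrite -[X in _ <= X]mulr1; apply: dP => //.
  - by rewrite /= !inE negb_or ab' ay' by'.
  - by rewrite !mdistC_norm -ab divff.
  - by rewrite /= !inE negb_or eq_sym ab' ay' by'.
  - by rewrite !mdistC_norm ab divff// -ab.
case: equidistant_distortion ge1 le1 => [s| |]//=; rewrite !lee_fin => s1 s2.
apply: eP; rewrite /= distrC ger0_norm ?subr_ge0//.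
by rewrite ltrBlDl (le_lt_trans s2)// ltrD2l ltr_pdivrMr// ltr_pMr// ltr1n.
Unshelve. all: by end_near. Qed.

(** Ratios up to [t1] have image ratios at most [t] by ratio control; the others lie between [t1]
    and [t], where asymptotic similarity applies. *)
Lemma similar_asymptotically_symmetric A h : {in A &, injective h} ->
  ratio_controlled A h -> asymptotically_similar A h -> asymptotically_symmetric A h.
Proof.
move=> h_inj [_ h_small] sim t t0 eps eps0.
have [t1 t10 t1P] := h_small _ t0.
have M0 : 0 < Num.max t t1^-1 by rewrite lt_max t0.
have [d d0 dP] := sim _ _ eps0 M0.
exists (d / 2); first by rewrite divr_gt0.
move=> a b x Aa Ab Ax; rewrite /= !inE negb_or => /and3P[/andP[ab ax] bx _] diam_d.
have bx0 : 0 < `|b - x| by rewrite normr_gt0 subr_eq0.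
have hbx0 : 0 < `|h b - h x|.
  rewrite normr_gt0 subr_eq0; apply/eqP => E.
  by have := h_inj _ _ (mem_set Ab) (mem_set Ax) E; apply/eqP.
have bxd : 0 < `|b - x| < d.
  rewrite bx0 /= (@le_lt_trans _ _ (d / 2))//; last by lra.
  rewrite -lee_fin; apply: le_trans diam_d; apply: le_diam; last by right.
  by left; right.
rewrite !mdistC_norm !ler_pdivrMr// => at_.
have [small|large] := leP `|a - x| (t1 * `|b - x|).
  rewrite (le_trans (t1P _ _ _ Aa Ab Ax small))// ler_wpM2r// ler_peMl ?(ltW t0)//.
  by rewrite lerDl ltW.
have le_M : `|a - x| <= Num.max t t1^-1 * `|b - x|.
  by rewrite (le_trans at_)// ler_wpM2r// le_max lexx.
have le_M' : `|b - x| <= Num.max t t1^-1 * `|a - x|.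
  rewrite -ler_pdivrMl ?lt_max ?t0// (@le_trans _ _ (t1 * `|b - x|))//; last exact: ltW.
  by rewrite ler_wpM2r// invf_ple ?posrE ?lt_max ?t0// le_max lexx orbT.
have := dP a b x Aa Ab Ax bxd le_M le_M'.
rewrite -ler_pdivlMr// => /le_trans; apply.
rewrite ler_pdivrMr// -!mulrA ler_pM2l ?addr_gt0//.
by rewrite mulrCA ler_pM2l// mulrC.
Qed.

(** The similarity of [k] is applied to [h v], [h u] and [h x]: exchanging [u] and [v] undoes the
    inversion, and ratio control bounds the ratios of these images. *)
Lemma asymptotically_similar_inverse A h k : {in A, cancel h k} ->
  ratio_controlled A h ->
  (forall eps, 0 < eps -> exists2 delta, 0 < delta & forall a x, A a -> A x ->
    `|a - x| < delta -> `|h a - h x| < eps) ->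
  asymptotically_similar (h @` A) k -> asymptotically_similar A h.
Proof.
move=> hK [h_bound _] h_unif sim eps M eps0 M0.
have hKP a : A a -> k (h a) = a by move=> Aa; apply: hK; rewrite inE.
have [s s0 sP] := h_bound _ M0.
have [d d0 dP] := sim _ _ eps0 s0.
have [e e0 eP] := h_unif _ d0.
exists (e / M); first by rewrite divr_gt0.
move=> u v x Au Av Ax /andP[vx0 vx] uv vu.
have hA a : A a -> (h @` A) (h a) by exists a.
have ux0 : 0 < `|u - x| by rewrite -(pmulr_rgt0 _ M0) (lt_le_trans vx0).
have := dP (h v) (h u) (h x) (hA _ Av) (hA _ Au) (hA _ Ax).
rewrite !hKP// [`|v - x| * _]mulrC [`|u - x| * _]mulrC; apply.
- rewrite eP ?andbT//; last by rewrite (le_lt_trans uv)// mulrC -ltr_pdivlMr.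
  rewrite normr_gt0 subr_eq0; apply/eqP => /(congr1 k); rewrite !hKP// => E.
  by rewrite E subrr normr0 ltxx in ux0.
- exact: sP.
- exact: sP.
Qed.
End asymptotic_symmetry.

Theorem theorem4p1 (R : realType) (Gamma1 Gamma2 : set (Rcomplex R))
    (h : Rcomplex R -> Rcomplex R)
    (qc1 : quasicircle Gamma1) (qc2 : quasicircle Gamma2)
    (qs_h : quasisymmetric Gamma1 h) (im_h : h @` Gamma1 = Gamma2)
    (ac : asymptotically_conformal Gamma1 \/ asymptotically_conformal Gamma2) :
  (equidistant_weakly_asymptotically_symmetric Gamma1 h ->
   asymptotically_symmetric Gamma1 h) /\
  ((equidistant_weakly_asymptotically_symmetric Gamma1 h <->
    weakly_asymptotically_symmetric Gamma1 h) /\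
   (weakly_asymptotically_symmetric Gamma1 h <->
    asymptotically_symmetric Gamma1 h)).
Proof.
have [T [Phi [loopP PhiE]]] := jordan_curve_loop qc1.1.
have h_ratio := quasisymmetric_ratio_controlled qs_h.
have [[k [h_cont _ hK]] _] := qs_h.
have h_inj : {in Gamma1 &, injective h} := can_in_inj hK.
have h_loopP : simple_loop T (h \o Phi).
  by apply: simple_loop_comp => //; rewrite PhiE.
have hPhiE : range (h \o Phi) = Gamma2 by rewrite -im_h -PhiE image_comp.
have circles1 : meets_small_circles Gamma1.
  by rewrite -PhiE; exact: loop_meets_small_circles loopP.
have ewas_as : equidistant_weakly_asymptotically_symmetric Gamma1 h ->
    asymptotically_symmetric Gamma1 h.
  move=> /(equidistant_weak_asymptotic h_inj) equi.
  apply: similar_asymptotically_symmetric => //; case: ac => [ac1|ac2].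
    move=> eps M eps0 M0; apply: asymptotic_similarity => //.
      by rewrite -PhiE; apply: loop_infinitesimally_linear loopP _; rewrite PhiE.
    by rewrite -PhiE; apply: (almost_symmetric_source loopP); rewrite PhiE.
  (* When the target is the asymptotically conformal curve, similarity is proved for [k] and
     transferred back to [h]. *)
  apply: (asymptotically_similar_inverse hK h_ratio) => [eps eps0|].
    have [d d0 dP] := loop_uniform_continuous h_loopP eps0.
    have [e e0 eP] := loop_inverse_uniform loopP d0.
    exists e => // a x; rewrite -PhiE => -[s _ <-] [t _ <-] /eP[t' t'E /dP].
    by rewrite /= t'E.
  move=> eps M eps0 M0; apply: asymptotic_similarity => //.
  - exact: ratio_controlled_inverse.
  - rewrite im_h -hPhiE.
    by apply: loop_infinitesimally_linear h_loopP _; rewrite hPhiE.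
  - by rewrite im_h -hPhiE; exact: loop_meets_small_circles h_loopP.
  - rewrite im_h -hPhiE.
    by apply: (almost_symmetric_target loopP); rewrite ?PhiE ?hPhiE.
have as_was : asymptotically_symmetric Gamma1 h ->
    weakly_asymptotically_symmetric Gamma1 h by move=> /(_ 1 ltr01).
have was_ewas : weakly_asymptotically_symmetric Gamma1 h ->
    equidistant_weakly_asymptotically_symmetric Gamma1 h.
  apply: weak_equidistant_weak => //.
  by exists (Phi 0); rewrite -PhiE; exists 0.
split=> //; split; split=> //.
- by move=> /ewas_as.
- by move=> /was_ewas.
Qed.
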